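(* Fix a polynomially bounded o-minimal expansion of $\mathbb{R}$. Let $\mathcal{A}$ be a definable family of subsets of $\mathbb{R}^n$ parametrized by the definable set $A$, and let $\mathcal{B}$ be a definable family of subsets of $\mathbb{R}^{n+1}$ parametrized by the definable set $B$. Then there exists $N = N(\mathcal{A},\mathcal{B}) > 0$ having the following property. For any triple of finite sets $(A',B',B'')$ with $A' \subset A$, $B',B'' \subset B$, any closed $(\mathcal{A},A')$-set $S$, any $(\mathcal{B},B')$-set $F$ and any $(\mathcal{B},B'')$-set $G$ such that $F,G$ are graphs of definable functions $f,g:\mathbb{R}^n \rightarrow \mathbb{R}$ that are continuous on $S$ and satisfy $f|_S^{-1}(0) \subset g|_S^{-1}(0)$, there exists a continuous definable function $h:S \rightarrow \mathbb{R}$ such that $g|_S^N = h\, f|_S$ on $S$.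
   Context: An o-minimal expansion of $\mathbb{R}$ is polynomially bounded if for every definable $h:\mathbb{R}\to\mathbb{R}$ there exist $N\in\mathbb{N}$, $c\in\mathbb{R}$ with $|h(x)|<x^N$ for all $x>c$. A definable family of subsets of $\mathbb{R}^n$ parametrized by a definable set $A$ is a definable subset $\mathcal{A}\subset A\times\mathbb{R}^n$; for $a\in A$, $\mathcal{A}_a=\{y : (a,y)\in\mathcal{A}\}$. For a finite $A'\subset A$, an $(\mathcal{A},A')$-set is any set in the Boolean algebra of subsets of $\mathbb{R}^n$ generated by the sets $\mathcal{A}_a$, $a\in A'$. *)

(* Defs.v *)
From Stdlib Require Import Reals List.
From mathcomp Require Import ssreflect ssrfun ssrbool eqtype ssrnat seq fintype.

Local Open Scope R_scope.

Definition Rn (n : nat) := 'I_n -> R.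

Definition init {n : nat} (z : Rn n.+1) : Rn n :=
  fun i => z (widen_ord (leqnSn n) i).
Definition tl {n : nat} (z : Rn n.+1) : Rn n := fun i => z (lift ord0 i).
Definition snoc {n : nat} (y : Rn n) (t : R) : Rn n.+1 :=
  fun i => match unlift ord_max i with Some j => y j | None => t end.
Definition concat {m n : nat} (a : Rn m) (y : Rn n) : Rn (m + n)%N :=
  fun i => match split i with inl j => a j | inr k => y k end.

Definition i30 : 'I_3 := @Ordinal 3 0 erefl.
Definition i31 : 'I_3 := @Ordinal 3 1 erefl.
Definition i32 : 'I_3 := @Ordinal 3 2 erefl.
Definition i20 : 'I_2 := @Ordinal 2 0 erefl.
Definition i21 : 'I_2 := @Ordinal 2 1 erefl.

Definition in_interval (iv : option R * option R) (x : R) : Prop :=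
  (match fst iv with Some a => a < x | None => True end) /\
  (match snd iv with Some b => x < b | None => True end).

(** [D n X] : "X is a definable subset of R^n".  An o-minimal expansion of
    the real field (R, <, +, times) (definability with parameters), in the sense of
    van den Dries' "structure on R": a sequence of Boolean algebras closed
    under products with R, containing diagonals, closed under projections,
    containing <, graphs of + and *, and all points, such that definable
    subsets of R are finite unions of points and open intervals. *)
Record ominimal_expansion (D : forall n : nat, (Rn n -> Prop) -> Prop) : Prop := {
  om_ext : forall n (X Y : Rn n -> Prop), D n X -> (forall x, X x <-> Y x) -> D n Y;
  om_empty : forall n, D n (fun _ => False);
  om_compl : forall n X, D n X -> D n (fun x => ~ X x);
  om_union : forall n X Y, D n X -> D n Y -> D n (fun x => X x \/ Y x);
  om_prodR : forall n X, D n X -> D n.+1 (fun z => X (init z));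
  om_Rprod : forall n X, D n X -> D n.+1 (fun z => X (tl z));
  om_diag : forall n (i j : 'I_n), D n (fun x => x i = x j);
  om_proj : forall n (X : Rn n.+1 -> Prop), D n.+1 X -> D n (fun y => exists t, X (snoc y t));
  om_point : forall r : R, D 1%N (fun x : Rn 1%N => x ord0 = r);
  om_lt : D 2%N (fun x => x i20 < x i21);
  om_add : D 3%N (fun x => x i30 + x i31 = x i32);
  om_mul : D 3%N (fun x => x i30 * x i31 = x i32);
  om_omin : forall X : Rn 1%N -> Prop, D 1%N X ->
    exists (pts : list R) (ivs : list (option R * option R)),
      forall x : R, X (fun _ => x) <->
        (List.In x pts \/ exists iv, List.In iv ivs /\ in_interval iv x)
}.

Definition graph {n : nat} (f : Rn n -> R) : Rn n.+1 -> Prop :=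
  fun z => z ord_max = f (init z).

Definition definable_fun (D : forall n : nat, (Rn n -> Prop) -> Prop)
  {n : nat} (f : Rn n -> R) : Prop := D n.+1 (graph f).

(** A function h : S -> R (represented by a total function; only its values
    on S matter) is definable: its graph over S is definable. *)
Definition definable_fun_on (D : forall n : nat, (Rn n -> Prop) -> Prop)
  {n : nat} (S : Rn n -> Prop) (h : Rn n -> R) : Prop :=
  D n.+1 (fun z => S (init z) /\ z ord_max = h (init z)).

Definition poly_bounded (D : forall n : nat, (Rn n -> Prop) -> Prop) : Prop :=
  forall h : R -> R, definable_fun D (fun y : Rn 1%N => h (y ord0)) ->
    exists (N : nat) (c : R), forall x, c < x -> Rabs (h x) < x ^ N.

Definition closed_in_Rn {n : nat} (S : Rn n -> Prop) : Prop :=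
  forall x, ~ S x -> exists eps, 0 < eps /\
    forall y, (forall i, Rabs (y i - x i) < eps) -> ~ S y.

Definition continuous_on_set {n : nat} (S : Rn n -> Prop) (f : Rn n -> R) : Prop :=
  forall x, S x -> forall eps, 0 < eps -> exists delta, 0 < delta /\
    forall y, S y -> (forall i, Rabs (y i - x i) < delta) -> Rabs (f y - f x) < eps.

Definition definable_family (D : forall n : nat, (Rn n -> Prop) -> Prop)
  {m n : nat} (A : Rn m -> Prop) (calA : Rn (m + n)%N -> Prop) : Prop :=
  D m A /\ D (m + n)%N calA /\ (forall a y, calA (concat a y) -> A a).

Definition fiber {m n : nat} (calA : Rn (m + n)%N -> Prop) (a : Rn m) : Rn n -> Prop :=
  fun y => calA (concat a y).

Inductive bool_gen {n : nat} (gens : list (Rn n -> Prop)) : (Rn n -> Prop) -> Prop :=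
| bg_gen X : List.In X gens -> bool_gen gens X
| bg_empty : bool_gen gens (fun _ => False)
| bg_compl X : bool_gen gens X -> bool_gen gens (fun x => ~ X x)
| bg_union X Y : bool_gen gens X -> bool_gen gens Y -> bool_gen gens (fun x => X x \/ Y x)
| bg_ext X Y : bool_gen gens X -> (forall x, X x <-> Y x) -> bool_gen gens Y.

Definition family_set {m n : nat} (calA : Rn (m + n)%N -> Prop) (A' : list (Rn m))
  (X : Rn n -> Prop) : Prop :=
  bool_gen (List.map (fiber calA) A') X.

(* Main.v *)
(* Uniform finiteness bounds the number of endpoints of the one-dimensional fibres
   of a definable family, so for any finite set of its members there is a
   cylindrical decomposition adapted to them whose cells all belong to one fixed
   definable family: a cell needs a number of parameters that does not depend on
   how many members are involved. On the cells, [S] and the graphs of [f] and [g]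
   are therefore uniformly definable, and so is, for a cell and a zero [x0] of [f],
   the infimum [phi t] of [|f|] over the points of the cell near [x0] where
   [|g| >= t]. It is positive by compactness. In a polynomially bounded structure
   a definable family of positive functions has a common lower bound [t ^ N] near
   [0]: if not, one defines from it a function growing faster than every
   polynomial. Hence [|g| ^ N < |f|] near [x0] where [g] does not vanish, and
   [g ^ (N + 1) / f] tends to [0] there. *)
Require Import Defs.
From Stdlib Require Import Reals List Lra Lia Classical ClassicalEpsilon FunctionalExtensionality.
From mathcomp Require Import ssreflect ssrfun ssrbool eqtype ssrnat seq fintype zify.
(* [List] and [seq] would otherwise shadow [init], [tl] and [concat]. *)
Import Defs.

Local Open Scope R_scope.

(** The obstacle is that [S], [F] and [G] are Boolean combinations of unbounded length, so they do
    not range over a definable family. What survives is that such a combination cannot separate two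
    points unless one of its generators does: a cell on which all generators are constant lies
    inside the set as soon as it meets it. This is all that is asked of a cell, and it is why cells
    can replace the sets themselves. The infimum is indexed by three cells at once, one for [S] and
    one for each graph, together with the base point. The exponent therefore depends on the two
    families only. The radius on which the bound holds does depend on the cells, but each choice of
    [A'], [B'], [B''] involves finitely many of them, and a minimum of radii suffices. Uniform
    finiteness is obtained by induction on the number of parameters: when the last parameter varies,
    fibres stay in local bijection except at finitely many values, and these exceptional values form
    a family with one parameter less. *)

Class omin := Omin {
  dset : forall n : nat, (Rn n -> Prop) -> Prop;
  dsetP : ominimal_expansion dset }.

(** * Renaming and projecting variables, from the axioms of a structure *)

Section Streams.
Context {OM : omin}.

Lemma dset_ext n (X Y : Rn n -> Prop) :
  dset n X -> (forall x, X x <-> Y x) -> dset n Y.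
Proof. exact: (om_ext _ dsetP). Qed.

Lemma dset_not n X : dset n X -> dset n (fun x => ~ X x).
Proof. exact: (om_compl _ dsetP). Qed.

Lemma dset_or n X Y : dset n X -> dset n Y -> dset n (fun x => X x \/ Y x).
Proof. exact: (om_union _ dsetP). Qed.

Lemma dset_and n X Y : dset n X -> dset n Y -> dset n (fun x => X x /\ Y x).
Proof.
move=> hX hY.
apply: dset_ext (dset_not _ _ (dset_or _ _ _ (dset_not _ _ hX) (dset_not _ _ hY))) _ => x.
tauto.
Qed.

Lemma dset_true n : dset n (fun _ => True).
Proof. by apply: dset_ext (dset_not _ _ (om_empty _ dsetP n)) _ => x; tauto. Qed.

(* Sets in the first [n] coordinates of a sequence: dimensions become plain
   numbers, so that no casts between [Rn (m + n)] and [Rn (n + m)] are needed. *)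
Definition sdef (n : nat) (P : (nat -> R) -> Prop) : Prop :=
  exists X, dset n X /\ forall rho, P rho <-> X (fun i : 'I_n => rho i).

Lemma sdef_ext n (P Q : (nat -> R) -> Prop) :
  sdef n P -> (forall rho, P rho <-> Q rho) -> sdef n Q.
Proof.
move=> [X [hX hP]] hPQ; exists X; split=> // rho.
by rewrite -hPQ.
Qed.

Lemma sdef_and n P Q : sdef n P -> sdef n Q -> sdef n (fun rho => P rho /\ Q rho).
Proof.
move=> [X [hX hP]] [Y [hY hQ]]; exists (fun x => X x /\ Y x); split.
  exact: dset_and.
by move=> rho; rewrite hP hQ.
Qed.

Lemma sdef_true n : sdef n (fun _ => True).
Proof. by exists (fun _ => True); split=> //; exact: dset_true. Qed.

Lemma sdef_all (I : finType) n (P : I -> (nat -> R) -> Prop) :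
  (forall i, sdef n (P i)) -> sdef n (fun rho => forall i, P i rho).
Proof.
move=> hP.
suff hs (s : seq I) : sdef n (fun rho => forall i, i \in s -> P i rho).
  apply: sdef_ext (hs (enum I)) _ => rho; split=> h i; last by move=> _.
  by apply: h; rewrite mem_enum.
elim: s => [|a s IHs].
  by apply: sdef_ext (sdef_true n) _ => rho; split.
apply: sdef_ext (sdef_and _ _ _ (hP a) IHs) _ => rho; split.
  by move=> [ha hs] i; rewrite inE => /orP [/eqP -> //|]; exact: hs.
by move=> h; split=> [|i hi]; apply: h; rewrite inE ?eqxx // hi orbT.
Qed.

Lemma sdef_eq n i j : (i < n)%N -> (j < n)%N -> sdef n (fun rho => rho i = rho j).
Proof.
move=> hi hj; exists (fun x => x (Ordinal hi) = x (Ordinal hj)); split=> //.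
exact: (om_diag _ dsetP).
Qed.

Lemma sdef_shift n k P :
  sdef n P -> sdef (k + n)%N (fun rho => P (fun i => rho (k + i)%N)).
Proof.
move=> hP; elim: k => [|k [X [hX hPX]]]; first by [].
rewrite addSn; exists (fun z => X (tl z)); split.
  exact: (om_Rprod _ dsetP).
by move=> rho; rewrite (hPX (fun i => rho i.+1)).
Qed.

Lemma sdef_proj1 n P :
  sdef n.+1 P ->
  sdef n (fun rho => exists t, P (fun i => if (i < n)%N then rho i else t)).
Proof.
move=> [X [hX hPX]]; exists (fun y => exists t, X (snoc y t)); split.
  exact: (om_proj _ dsetP).
move=> rho; split=> -[t ht]; exists t.
  move/hPX: ht; congr X; apply: functional_extensionality => i.
  rewrite /snoc; case: unliftP => [j ->|->] /=; last by rewrite ltnn.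
  by have hj : (j < n)%N := ltn_ord j; rewrite /bump [(n <= j)%N]leqNgt hj /= add0n hj.
apply/hPX; move: ht; congr X; apply: functional_extensionality => i.
rewrite /snoc; case: unliftP => [j ->|->] /=; last by rewrite ltnn.
by have hj : (j < n)%N := ltn_ord j; rewrite /bump [(n <= j)%N]leqNgt hj /= add0n hj.
Qed.

Lemma sdef_local n P (rho rho' : nat -> R) :
  sdef n P -> (forall i, (i < n)%N -> rho i = rho' i) -> P rho -> P rho'.
Proof.
move=> [X [_ hPX]] h /hPX hX; apply/hPX; move: hX.
by congr X; apply: functional_extensionality => i; exact: h.
Qed.

Lemma sdef_proj n k P :
  sdef (n + k)%N P ->
  sdef n (fun rho => exists w : nat -> R,
    P (fun i => if (i < n)%N then rho i else w (i - n)%N)).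
Proof.
elim: k P => [|k IHk] P.
  rewrite addn0 => hP; apply: (sdef_ext _ _ _ hP) => rho.
  split=> [h|[w]]; first exists (fun _ => 0); last move=> h.
    by apply: (sdef_local _ _ _ _ hP _ h) => i ->.
  by apply: (sdef_local _ _ _ _ hP _ h) => i ->.
rewrite addnS => hP; have /IHk h := sdef_proj1 _ _ hP.
apply: sdef_ext h _ => rho; split.
  move=> [w [t h]]; exists (fun j => if (j < k)%N then w j else t).
  apply: sdef_local hP _ h => i _.
  case: (ltnP i n) => h1; first by rewrite ltn_addr.
  by case: ltnP => h2; case: ltnP => h3 //; lia.
move=> [w h]; exists w, (w k).
apply: sdef_local hP _ h => i hi.
case: (ltnP i n) => h1; first by rewrite ltn_addr.
case: ltnP => h2 //.
by have -> : (i - n = k)%N by lia.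
Qed.

Lemma dset_sdef n X : dset n X -> sdef n (fun rho => X (fun i => rho i)).
Proof. by move=> hX; exists X. Qed.

Definition pad {n} (x : Rn n) : nat -> R :=
  fun i => if insub i is Some j then x j else 0.

Lemma padE n (x : Rn n) (i : 'I_n) : pad x i = x i.
Proof. by rewrite /pad valK. Qed.

Lemma sdef_dset n P : sdef n P -> dset n (fun x => P (pad x)).
Proof.
move=> [X [hX hPX]]; apply: dset_ext hX _ => x; rewrite hPX.
by have -> : (fun i : 'I_n => pad x i) = x
  by apply: functional_extensionality => i; rewrite padE.
Qed.

(** Append [m] fresh coordinates that satisfy [X], equate the [i]-th of them with coordinate [s i]
    by a diagonal, and project them away. *)
Lemma dset_subst m n (X : Rn m -> Prop) (s : 'I_m -> 'I_n) :
  dset m X -> dset n (fun x => X (fun i => x (s i))).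
Proof.
move=> /dset_sdef /(sdef_shift _ n) hX.
have hE : sdef (n + m) (fun rho => forall i : 'I_m, rho (n + i)%N = rho (s i)).
  by apply: sdef_all => i; apply: sdef_eq; have := ltn_ord i; have := ltn_ord (s i); lia.
have /sdef_proj/sdef_dset h := sdef_and _ _ _ hX hE.
apply: dset_ext h _ => x.
have nlt (i : 'I_m) : (n + i < n)%N = false by lia.
split=> [[w [hw E]]|h].
  move: hw; congr X; apply: functional_extensionality => i.
  by move: (E i); rewrite nlt ltn_ord padE.
exists (pad (fun i => x (s i))).
have E (i : 'I_m) : pad (fun i => x (s i)) (n + i - n)%N = x (s i).
  by rewrite addKn padE.
split=> [|i]; last by rewrite nlt ltn_ord padE E.
move: h; congr X; apply: functional_extensionality => i.
by rewrite nlt E.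
Qed.

Lemma dset_proj n k (X : Rn (n + k)%N -> Prop) :
  dset (n + k)%N X -> dset n (fun y => exists w : Rn k, X (concat y w)).
Proof.
move=> /dset_sdef /sdef_proj /sdef_dset h; apply: dset_ext h _ => y.
split=> -[w h]; [exists (fun i => w i)|exists (pad w)]; move: h;
  congr X; apply: functional_extensionality => i; rewrite /concat;
  by case: splitP => j ->; rewrite ?addKn ?padE.
Qed.

End Streams.

(** * Definable sets over finite products *)

(** A bijection with some [Rn] lets nested tuples of parameters be used directly, without flattening
    them by hand. *)
Class space (T : Type) := Space {
  dim : nat;
  enc : T -> Rn dim;
  dec : Rn dim -> T;
  encK : forall x, dec (enc x) = x;
  decK : forall z, enc (dec z) = z }.
Arguments dim T {_}.

#[refine] Instance space_Rn n : space (Rn n) := {| dim := n; enc := id; dec := id |}.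
Proof. all: by []. Defined.

#[refine] Instance space_R : space R :=
  {| dim := 1; enc := fun r _ => r; dec := fun z => z ord0 |}.
Proof.
  by [].
by move=> z; apply: functional_extensionality => i; rewrite ord1.
Defined.

#[refine] Instance space_prod T U (sT : space T) (sU : space U) : space (T * U) :=
  {| dim := (dim T + dim U)%N;
     enc := fun p => concat (enc p.1) (enc p.2);
     dec := fun z => (dec (fun i => z (lshift _ i)), dec (fun i => z (rshift _ i))) |}.
Proof.
  move=> [x y]; congr pair; rewrite -[RHS]encK; congr dec;
    apply: functional_extensionality => i; rewrite /concat;
    by rewrite ?(unsplitK (inl i)) ?(unsplitK (inr i)).
move=> z; apply: functional_extensionality => i; rewrite /concat /= !decK.
by case: splitP => j hj; congr z; apply: val_inj.
Defined.

Section Definable.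
Context {OM : omin}.

Definition Def {T} {sT : space T} (P : T -> Prop) : Prop :=
  dset (dim T) (fun z => P (dec z)).

Definition dmap {T U} {sT : space T} {sU : space U} (f : T -> U) : Prop :=
  Def (fun p : T * U => f p.1 = p.2).

Lemma Def_ext {T} {sT : space T} (P Q : T -> Prop) : Def P -> (forall x, P x <-> Q x) -> Def Q.
Proof. by move=> hP h; apply: dset_ext hP _ => z; exact: h. Qed.

Lemma Def_not {T} {sT : space T} (P : T -> Prop) : Def P -> Def (fun x => ~ P x).
Proof. exact: dset_not. Qed.

Lemma Def_or {T} {sT : space T} (P Q : T -> Prop) : Def P -> Def Q -> Def (fun x => P x \/ Q x).
Proof. exact: dset_or. Qed.

Lemma Def_and {T} {sT : space T} (P Q : T -> Prop) : Def P -> Def Q -> Def (fun x => P x /\ Q x).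
Proof. exact: dset_and. Qed.

Lemma Def_imp {T} {sT : space T} (P Q : T -> Prop) : Def P -> Def Q -> Def (fun x => P x -> Q x).
Proof.
move=> hP hQ; apply: Def_ext (Def_or _ _ (Def_not _ hP) hQ) _ => x.
by case: (classic (P x)); tauto.
Qed.

Lemma Def_iff {T} {sT : space T} (P Q : T -> Prop) : Def P -> Def Q -> Def (fun x => P x <-> Q x).
Proof. by move=> hP hQ; apply: Def_and; apply: Def_imp. Qed.

Lemma Def_const {T} {sT : space T} (A : Prop) : Def (fun _ : T => A).
Proof.
case: (classic A) => h.
  by apply: dset_ext (dset_true _) _ => x; split.
by apply: dset_ext (dset_not _ _ (dset_true _)) _ => x; tauto.
Qed.

Lemma Def_forall_fin {T} {sT : space T} (I : finType) (P : I -> T -> Prop) :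
  (forall i, Def (P i)) -> Def (fun x => forall i, P i x).
Proof.
move=> hP.
have hs : forall s : seq I, Def (fun x => forall i, i \in s -> P i x).
  elim=> [|a s IHs].
    by apply: Def_ext (@Def_const T sT True) _ => rho; split.
  apply: Def_ext (Def_and _ _ (hP a) IHs) _ => x; split.
    by move=> [ha hs] i; rewrite inE => /orP [/eqP -> //|]; exact: hs.
  by move=> h; split=> [|i hi]; apply: h; rewrite inE ?eqxx // hi orbT.
apply: Def_ext (hs (enum I)) _ => rho; split=> h i; last by move=> _.
by apply: h; rewrite mem_enum.
Qed.

Lemma Def_ex {T U} {sT : space T} {sU : space U} (P : T -> U -> Prop) :
  Def (fun p : T * U => P p.1 p.2) -> Def (fun x => exists u, P x u).
Proof.
move=> /dset_proj h; apply: dset_ext h _ => z /=.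
have E w : (fun i => @concat (dim T) (dim U) z w (lshift _ i)) = z.
  by apply: functional_extensionality => i; rewrite /concat (unsplitK (inl i)).
have E' w : (fun i => @concat (dim T) (dim U) z w (rshift _ i)) = w.
  by apply: functional_extensionality => i; rewrite /concat (unsplitK (inr i)).
split=> [[w]|[u h]]; first by rewrite E E'; exists (dec w).
by exists (enc u); rewrite E E' encK.
Qed.

Lemma Def_all {T U} {sT : space T} {sU : space U} (P : T -> U -> Prop) :
  Def (fun p : T * U => P p.1 p.2) -> Def (fun x => forall u, P x u).
Proof.
move=> hP; have h := Def_not _ (Def_ex (fun x u => ~ P x u) (Def_not _ hP)).
apply: Def_ext h _ => x; split; last by move=> h [u]; exact.
by move=> h u; apply: NNPP => hu; apply: h; exists u.
Qed.

(* Maps that only copy coordinates; definable sets pull back along them by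
   renaming variables. *)
Definition cmap {T U} {sT : space T} {sU : space U} (f : T -> U) : Prop :=
  exists s : 'I_(dim U) -> 'I_(dim T), forall x i, enc (f x) i = enc x (s i).

Lemma cmap_id {T} {sT : space T} : cmap (fun x : T => x).
Proof. by exists id. Qed.

Lemma cmap_comp {T U V} {sT : space T} {sU : space U} {sV : space V}
    (g : U -> V) (f : T -> U) :
  cmap g -> cmap f -> cmap (fun x => g (f x)).
Proof.
by move=> [s hs] [r hr]; exists (fun i => r (s i)) => x i; rewrite hs hr.
Qed.

Lemma cmap_fst {T U} {sT : space T} {sU : space U} : cmap (@fst T U).
Proof.
by exists (fun i => lshift _ i) => x i /=; rewrite /concat (unsplitK (inl i)).
Qed.

Lemma cmap_snd {T U} {sT : space T} {sU : space U} : cmap (@snd T U).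
Proof.
by exists (fun i => rshift _ i) => x i /=; rewrite /concat (unsplitK (inr i)).
Qed.

Lemma cmap_pair {T U V} {sT : space T} {sU : space U} {sV : space V}
    (f : T -> U) (g : T -> V) :
  cmap f -> cmap g -> cmap (fun x => (f x, g x)).
Proof.
move=> [s hs] [r hr].
exists (fun i => match split i with inl j => s j | inr k => r k end) => x i /=.
by rewrite /concat; case: (split i).
Qed.

Lemma Def_cmap {T U} {sT : space T} {sU : space U} (f : T -> U) (P : U -> Prop) :
  cmap f -> Def P -> Def (fun x => P (f x)).
Proof.
move=> [s hs] /(dset_subst _ _ _ s) h; apply: dset_ext h _ => z /=.
have -> // : (fun i => z (s i)) = enc (f (dec z)).
  by apply: functional_extensionality => i; rewrite hs decK.
by rewrite encK.
Qed.

Lemma enc_inj {T} {sT : space T} (x y : T) : (forall i, enc x i = enc y i) -> x = y.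
Proof.
move=> h; rewrite -(encK x) -(encK y); congr dec.
exact: functional_extensionality.
Qed.

Lemma cmap_dmap {T U} {sT : space T} {sU : space U} (f : T -> U) : cmap f -> dmap f.
Proof.
move=> [s hs].
have h : Def (fun z : Rn (dim T + dim U) => forall i : 'I_(dim U),
    z (lshift _ (s i)) = z (rshift _ i)).
  by apply: Def_forall_fin => i; exact: (om_diag _ dsetP).
apply: dset_ext h _ => z /=; split=> h.
  by apply: enc_inj => i; rewrite hs !decK.
by move=> i; move: (f_equal (fun u => enc u i) h); rewrite hs !decK.
Qed.

Lemma Def_pull {T U} {sT : space T} {sU : space U} (P : U -> Prop) (f : T -> U) :
  Def P -> dmap f -> Def (fun x => P (f x)).
Proof.
move=> hP hf.
have h := Def_ex (fun x u => f x = u /\ P u)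
  (Def_and _ _ hf (Def_cmap snd P cmap_snd hP)).
apply: Def_ext h _ => x; split=> [[u [<- //]]|h]; by exists (f x).
Qed.

Lemma dmap_id {T} {sT : space T} : dmap (fun x : T => x).
Proof. exact: cmap_dmap cmap_id. Qed.

Lemma dmap_fst {T U} {sT : space T} {sU : space U} : dmap (@fst T U).
Proof. exact: cmap_dmap cmap_fst. Qed.

Lemma dmap_snd {T U} {sT : space T} {sU : space U} : dmap (@snd T U).
Proof. exact: cmap_dmap cmap_snd. Qed.

Lemma dmap_pair {T U V} {sT : space T} {sU : space U} {sV : space V}
    (f : T -> U) (g : T -> V) :
  dmap f -> dmap g -> dmap (fun x => (f x, g x)).
Proof.
move=> hf hg.
have c1 : cmap (fun p : T * (U * V) => (p.1, p.2.1)).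
  by apply: cmap_pair; [exact: cmap_fst|apply: (cmap_comp fst snd); [exact: cmap_fst|exact: cmap_snd]].
have c2 : cmap (fun p : T * (U * V) => (p.1, p.2.2)).
  by apply: cmap_pair; [exact: cmap_fst|apply: (cmap_comp snd snd); exact: cmap_snd].
apply: Def_ext (Def_and _ _ (Def_cmap _ _ c1 hf) (Def_cmap _ _ c2 hg)) _.
by move=> [x [u v]] /=; split=> [[-> ->]|[-> ->]].
Qed.

Lemma dmap_comp {T U V} {sT : space T} {sU : space U} {sV : space V}
    (g : U -> V) (f : T -> U) :
  dmap g -> dmap f -> dmap (fun x => g (f x)).
Proof.
move=> hg hf.
have c1 : cmap (fun p : (T * V) * U => (p.1.1, p.2)).
  by apply: cmap_pair; [apply: (cmap_comp fst fst); exact: cmap_fst|exact: cmap_snd].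
have c2 : cmap (fun p : (T * V) * U => (p.2, p.1.2)).
  by apply: cmap_pair; [exact: cmap_snd|apply: (cmap_comp snd fst); [exact: cmap_snd|exact: cmap_fst]].
have h := Def_ex (fun (p : T * V) u => f p.1 = u /\ g u = p.2)
  (Def_and _ _ (Def_cmap _ _ c1 hf) (Def_cmap _ _ c2 hg)).
apply: Def_ext h _ => -[x v] /=; split=> [[u [<- //]]|h]; by exists (f x).
Qed.

Lemma Def_eq {T U} {sT : space T} {sU : space U} (f g : T -> U) :
  dmap f -> dmap g -> Def (fun x => f x = g x).
Proof. by move=> hf hg; apply: (Def_pull _ _ hf (dmap_pair _ _ dmap_id hg)). Qed.

Lemma dmap_cst {T U} {sT : space T} {sU : space U} (u : U) : dmap (fun _ : T => u).
Proof.
have hr (r : R) : Def (fun x : R => x = r) by exact: (om_point _ dsetP).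
have hu : Def (fun v : U => forall i, enc v i = enc u i).
  apply: Def_forall_fin => i.
  have c : cmap (fun v : U => enc v i) by exists (fun _ => i).
  exact: (Def_cmap _ _ c (hr (enc u i))).
apply: Def_ext (Def_cmap _ _ cmap_snd hu) _ => -[x v] /=.
by split=> [h|->] //; apply: enc_inj => i; rewrite h.
Qed.

Lemma Def_lt {T} {sT : space T} (f g : T -> R) :
  dmap f -> dmap g -> Def (fun x => f x < g x).
Proof.
move=> hf hg; have h := om_lt _ (@dsetP OM).
have hlt : Def (fun p : R * R => p.1 < p.2).
  refine (dset_ext 2 _ _ h _) => z /=.
  have -> : z i20 = z (@lshift 1 1 ord0) by congr z; exact: val_inj.
  by have -> : z i21 = z (@rshift 1 1 ord0) by congr z; exact: val_inj.
exact: (Def_pull _ _ hlt (dmap_pair _ _ hf hg)).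
Qed.

Lemma dmap_add {T} {sT : space T} (f g : T -> R) :
  dmap f -> dmap g -> dmap (fun x => f x + g x).
Proof.
move=> hf hg; have h := om_add _ (@dsetP OM).
have hadd : dmap (fun p : R * R => p.1 + p.2).
  refine (dset_ext 3 _ _ h _) => z /=.
  have -> : z i30 = z (@lshift 2 1 (@lshift 1 1 ord0)) by congr z; exact: val_inj.
  have -> : z i31 = z (@lshift 2 1 (@rshift 1 1 ord0)) by congr z; exact: val_inj.
  by have -> : z i32 = z (@rshift 2 1 ord0) by congr z; exact: val_inj.
exact: (dmap_comp _ _ hadd (dmap_pair _ _ hf hg)).
Qed.

Lemma dmap_mul {T} {sT : space T} (f g : T -> R) :
  dmap f -> dmap g -> dmap (fun x => f x * g x).
Proof.
move=> hf hg; have h := om_mul _ (@dsetP OM).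
have hmul : dmap (fun p : R * R => p.1 * p.2).
  refine (dset_ext 3 _ _ h _) => z /=.
  have -> : z i30 = z (@lshift 2 1 (@lshift 1 1 ord0)) by congr z; exact: val_inj.
  have -> : z i31 = z (@lshift 2 1 (@rshift 1 1 ord0)) by congr z; exact: val_inj.
  by have -> : z i32 = z (@rshift 2 1 ord0) by congr z; exact: val_inj.
exact: (dmap_comp _ _ hmul (dmap_pair _ _ hf hg)).
Qed.

Lemma dmap_coord {T} {sT : space T} {n} (v : T -> Rn n) (i : 'I_n) :
  dmap v -> dmap (fun x => v x i).
Proof.
by apply: (dmap_comp (fun y : Rn n => y i)); apply: cmap_dmap; exists (fun _ => i).
Qed.

Lemma dmap_init {n} : dmap (@init n).
Proof. by apply: cmap_dmap; exists (fun i => widen_ord (leqnSn n) i). Qed.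

Lemma dmap_snoc {n} : dmap (fun p : Rn n * R => snoc p.1 p.2).
Proof.
apply: cmap_dmap.
exists (fun i => match unlift ord_max i with Some j => lshift 1 j | None => rshift n ord0 end).
move=> [x t] i /=; rewrite /snoc /concat; case: unlift => [j|].
  by rewrite (unsplitK (inl j)).
by rewrite (unsplitK (inr ord0)).
Qed.

Lemma dmap_concat {m n} : dmap (fun p : Rn m * Rn n => concat p.1 p.2).
Proof. by apply: cmap_dmap; exists id. Qed.

Lemma Def_le {T} {sT : space T} (f g : T -> R) :
  dmap f -> dmap g -> Def (fun x => f x <= g x).
Proof.
move=> hf hg; apply: Def_ext (Def_not _ (Def_lt _ _ hg hf)) _ => x.
by split; [exact: Rnot_lt_le|exact: Rle_not_lt].
Qed.

Lemma dmap_opp {T} {sT : space T} (f : T -> R) : dmap f -> dmap (fun x => - f x).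
Proof.
move=> hf; apply: Def_ext (dmap_mul _ _ (dmap_cst (-1)) hf) _ => -[x y] /=.
by split=> [<-|<-]; lra.
Qed.

Lemma dmap_sub {T} {sT : space T} (f g : T -> R) :
  dmap f -> dmap g -> dmap (fun x => f x - g x).
Proof. by move=> hf hg; exact: (dmap_add _ _ hf (dmap_opp _ hg)). Qed.

Lemma dmap_pow {T} {sT : space T} (f : T -> R) (k : nat) :
  dmap f -> dmap (fun x => f x ^ k).
Proof.
move=> hf; elim: k => [|k IHk] /=; first exact: dmap_cst.
exact: dmap_mul.
Qed.

Lemma dmap_graph {T U} {sT : space T} {sU : space U} (f : T -> U) (P : T -> U -> Prop) :
  (forall x u, P x u <-> f x = u) -> Def (fun p : T * U => P p.1 p.2) -> dmap f.
Proof. by move=> h hP; apply: Def_ext hP _ => -[x u]; exact: h. Qed.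

Lemma dmap_if {T U} {sT : space T} {sU : space U} (P : T -> Prop) (f g : T -> U) :
  Def P -> dmap f -> dmap g ->
  dmap (fun x => if excluded_middle_informative (P x) then f x else g x).
Proof.
move=> hP hf hg.
apply: (dmap_graph _ (fun x u => (P x /\ f x = u) \/ (~ P x /\ g x = u))).
  by move=> x u; case: excluded_middle_informative => h /=; tauto.
by apply: Def_or; apply: Def_and => //; [|apply: Def_not];
  apply: (Def_pull _ _ hP dmap_fst).
Qed.

Lemma dmap_inv {T} {sT : space T} (f : T -> R) : dmap f -> dmap (fun x => / f x).
Proof.
move=> hf.
have hinv : dmap (fun x : R => / x).
  (* The equation [x * u = 1] misses [x = 0], where the total inverse still has a value. *)
  apply: (dmap_graph _ (fun x u => (x = 0 /\ u = / 0) \/ x * u = 1)).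
    move=> x u; split.
      case=> [[-> ->] //|h].
      have hx : x <> 0 by move=> h0; rewrite h0 in h; lra.
      by apply: (Rmult_eq_reg_l x) => //; rewrite h Rinv_r.
    move=> <-; case: (Req_dec x 0) => hx; [left|right]; first by rewrite hx.
    by rewrite Rinv_r.
  by apply: Def_or; [apply: Def_and|]; apply: Def_eq;
    first [exact: dmap_cst|exact: dmap_fst|exact: dmap_snd|
           apply: dmap_mul; [exact: dmap_fst|exact: dmap_snd]].
exact: (dmap_comp _ _ hinv hf).
Qed.

Lemma dmap_div {T} {sT : space T} (f g : T -> R) :
  dmap f -> dmap g -> dmap (fun x => f x / g x).
Proof. by move=> hf hg; exact: (dmap_mul _ _ hf (dmap_inv _ hg)). Qed.

Lemma dmap_abs {T} {sT : space T} (f : T -> R) : dmap f -> dmap (fun x => Rabs (f x)).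
Proof.
move=> hf.
have h := dmap_if (fun x => f x < 0) _ _ (Def_lt _ _ hf (dmap_cst 0)) (dmap_opp _ hf) hf.
apply: Def_ext h _ => -[x u] /=.
case: excluded_middle_informative => h; first by rewrite Rabs_left.
by rewrite Rabs_pos_eq //; lra.
Qed.

End Definable.

(** Reads definability off the shape of a first-order formula. A formula without the variable
    defines everything or nothing, hence is accepted outright; goals of unknown shape are left
    open. *)
Ltac definability :=
  cbv beta;
  try assumption;
  lazymatch goal with
  | |- Def (fun _ => ?A) => apply Def_const
  | |- Def (fun x => ~ _) => apply Def_not; definability
  | |- Def (fun x => _ /\ _) => apply Def_and; definability
  | |- Def (fun x => _ \/ _) => apply Def_or; definability
  | |- Def (fun x => _ <-> _) => apply Def_iff; definability
  | |- Def (fun x => _ < _) => apply Def_lt; definability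
  | |- Def (fun x => _ > _) => apply Def_lt; definability
  | |- Def (fun x => _ <= _) => apply Def_le; definability
  | |- Def (fun x => _ >= _) => apply Def_le; definability
  | |- Def (fun x => _ = _) => apply Def_eq; definability
  | |- Def (fun x => (@?A x) -> (@?B x)) => apply (Def_imp A B); definability
  | |- Def (fun x => exists _, _) => apply Def_ex; definability
  | |- Def (fun x => forall _ : Finite.sort _, _) => apply Def_forall_fin; intro; definability
  | |- Def (fun x => forall _ : ordinal _, _) =>
      refine (Def_forall_fin (fintype_ordinal__canonical__fintype_Finite _) _ _); intro; definability
  | |- Def (fun x => forall _, _) => apply Def_all; definability
  | |- Def (fun x => ?P (@?f x)) => apply (Def_pull P f); definability
  | |- dmap (fun x => x) => apply dmap_id
  | |- dmap (fun _ => ?c) => apply dmap_cst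
  | |- dmap (fun x => (_, _)) => apply dmap_pair; definability
  | |- dmap (fun x => fst (@?f x)) => apply (dmap_comp fst f); [apply dmap_fst|definability]
  | |- dmap (fun x => snd (@?f x)) => apply (dmap_comp snd f); [apply dmap_snd|definability]
  | |- dmap (fun x => _ + _) => apply dmap_add; definability
  | |- dmap (fun x => _ - _) => apply dmap_sub; definability
  | |- dmap (fun x => _ * _) => apply dmap_mul; definability
  | |- dmap (fun x => _ / _) => apply dmap_div; definability
  | |- dmap (fun x => - _) => apply dmap_opp; definability
  | |- dmap (fun x => / _) => apply dmap_inv; definability
  | |- dmap (fun x => Rabs _) => apply dmap_abs; definability
  | |- dmap (fun x => _ ^ _) => apply dmap_pow; definability
  | |- dmap (fun x => if is_left (excluded_middle_informative (@?P x)) then _ else _) =>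
      apply (dmap_if P); definability
  | |- dmap (fun x => init (@?f x)) => apply (dmap_comp init f); [apply dmap_init|definability]
  | |- dmap (fun x => snoc (@?f x) (@?g x)) =>
      apply (dmap_comp (fun p => snoc p.1 p.2) (fun x => (f x, g x)));
      [apply dmap_snoc|definability]
  | |- dmap (fun x => concat (@?f x) (@?g x)) =>
      apply (dmap_comp (fun p => concat p.1 p.2) (fun x => (f x, g x)));
      [apply dmap_concat|definability]
  | |- dmap (fun x => fst (@?f x) ?i) => apply (dmap_coord (fun x => fst (f x)) i); definability
  | |- dmap (fun x => snd (@?f x) ?i) => apply (dmap_coord (fun x => snd (f x)) i); definability
  | |- dmap (fun x => init (@?f x) ?i) => apply (dmap_coord (fun x => init (f x)) i); definability
  | |- dmap (fun x => x ?i) => apply (dmap_coord (fun x => x) i dmap_id)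
  | |- dmap (fun x => ?e (@?f x)) => apply (dmap_comp e f); definability
  | |- dmap (pair ?c) => apply (dmap_pair (fun _ => c) (fun x => x)); definability
  | |- dmap fst => apply dmap_fst
  | |- dmap snd => apply dmap_snd
  | |- _ => idtac
  end.

(** * Compactness and finite sets of reals *)

Lemma Rabs_le_bounds (x M : R) : Rabs x <= M -> - M <= x <= M.
Proof.
by move=> h; have := Rle_abs x; have := Rle_abs (- x); rewrite Rabs_Ropp; lra.
Qed.

(** Compactness for a property of sets instead of an open cover: an initial segment with the
    property can be prolonged past the supremum of all such segments, unless this supremum is
    [b]. *)
Lemma interval_compact (Q : (R -> Prop) -> Prop) (a b : R) :
  (forall X Y : R -> Prop, (forall x, X x -> Y x) -> Q Y -> Q X) ->
  (forall X Y, Q X -> Q Y -> Q (fun x => X x \/ Y x)) ->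
  (forall x, a <= x <= b -> exists e, 0 < e /\ Q (fun y => Rabs (y - x) < e)) ->
  a <= b -> Q (fun x => a <= x <= b).
Proof.
move=> mono union loc hab.
pose E c := a <= c <= b /\ Q (fun x => a <= x <= c).
have Ea : E a.
  split; first lra.
  have [e [he hQ]] := loc a (conj (Rle_refl a) hab).
  apply: mono hQ => x /= hx; have -> : x - a = 0 by lra.
  by rewrite Rabs_R0.
have [c [ub lub]] : {m | is_lub E m}.
  apply: completeness; last by exists a.
  by exists b => x [hx _]; lra.
have ac : a <= c by apply: ub.
have cb : c <= b by apply: lub => x [hx _]; lra.
have [e [he hQ]] := loc c (conj ac cb).
have [d [[hd hQd] hcd]] : exists d, E d /\ c - e < d.
  apply: NNPP => hn; have : c <= c - e; last lra.
  apply: lub => x hx; case: (Rle_dec x (c - e)) => // h.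
  by case: hn; exists x; split=> //; lra.
have hE : E (Rmin b (c + e / 2)).
  have [h1 h2] := (Rmin_l b (c + e / 2), Rmin_r b (c + e / 2)).
  have h3 : a <= Rmin b (c + e / 2) by apply: Rmin_glb; lra.
  split; first lra.
  apply: mono (union _ _ hQd hQ) => x hx.
  case: (Rle_dec x d) => hxd; [by left; lra|right].
  by apply: Rabs_def1; lra.
have h := ub _ hE.
have hb : Rmin b (c + e / 2) = b.
  by move: h; rewrite /Rmin; case: Rle_dec => // _; lra.
by case: hE => _; rewrite hb.
Qed.

Lemma interval_connected (P : R -> Prop) (a b : R) :
  (forall x, a <= x <= b ->
    exists e, 0 < e /\ forall y, Rabs (y - x) < e -> (P y <-> P x)) ->
  a <= b -> (P a <-> P b).
Proof.
move=> loc hab.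
pose E c := a <= c <= b /\ (P a <-> P c).
have Ea : E a by split; [lra|tauto].
have [c [ub lub]] : {m | is_lub E m}.
  apply: completeness; last by exists a.
  by exists b => x [hx _]; lra.
have ac : a <= c by apply: ub.
have cb : c <= b by apply: lub => x [hx _]; lra.
have [e [he hP]] := loc c (conj ac cb).
have [d [[hd hPd] hcd]] : exists d, E d /\ c - e < d.
  apply: NNPP => hn; have : c <= c - e; last lra.
  apply: lub => x hx; case: (Rle_dec x (c - e)) => // h.
  by case: hn; exists x; split=> //; lra.
have dc : d <= c by apply: ub.
have hPc : P a <-> P c.
  by rewrite hPd; apply: hP; apply: Rabs_def1; lra.
have hE : E (Rmin b (c + e / 2)).
  have [h1 h2] := (Rmin_l b (c + e / 2), Rmin_r b (c + e / 2)).
  have h3 : c <= Rmin b (c + e / 2) by apply: Rmin_glb; lra.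
  split; first lra.
  by rewrite hPc; symmetry; apply: hP; apply: Rabs_def1; lra.
have h := ub _ hE.
have hb : Rmin b (c + e / 2) = b.
  by move: h; rewrite /Rmin; case: Rle_dec => // _; lra.
by case: hE => _; rewrite hb.
Qed.

Lemma geometric_small (c r e : R) : 0 <= r < 1 -> 0 < e -> exists n, c * r ^ n < e.
Proof.
move=> hr he; case: (Rle_dec c 0) => hc; first by exists 0%N => /=; lra.
have r1 : Rabs r < 1 by rewrite Rabs_pos_eq; lra.
have hec : 0 < e / c by apply: Rdiv_lt_0_compat; lra.
have [N hN] := pow_lt_1_zero r r1 _ hec.
exists N; have := hN N (Nat.le_refl N).
rewrite Rabs_pos_eq; last by apply: pow_le; lra.
move=> h; have := Rmult_lt_compat_l c _ _ _ h.
have -> : c * (e / c) = e by field; lra.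
by apply; lra.
Qed.

(** Thresholds are required to work for all smaller values too, which is what allows them to be
    merged by a minimum. *)
Lemma list_min_pos {A} (l : list A) (P : A -> R -> Prop) :
  (forall x, List.In x l -> exists e, 0 < e /\ forall e', 0 < e' <= e -> P x e') ->
  exists e, 0 < e /\ forall e', 0 < e' <= e -> forall x, List.In x l -> P x e'.
Proof.
elim: l => [|a l IH] h; first by exists 1; split=> //; lra.
have [|e1 [he1 h1]] := IH; first by move=> x hx; apply: h; right.
have [|e2 [he2 h2]] := h a; first by left.
exists (Rmin e1 e2); split; first exact: Rmin_glb_lt.
have [m1 m2] := (Rmin_l e1 e2, Rmin_r e1 e2).
by move=> e' he' x [<-|hx]; [apply: h2|apply: h1 => //]; lra.
Qed.

Lemma list_gap (l : list R) (c : R) :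
  exists e, 0 < e /\ forall y, List.In y l -> y <> c -> e <= Rabs (y - c).
Proof.
have [x hx|e [he h]] := list_min_pos l (fun y e => y <> c -> e <= Rabs (y - c)).
  case: (Req_dec x c) => hxc; first by exists 1; split; [lra|].
  by exists (Rabs (x - c)); split; [apply: Rabs_pos_lt; lra|move=> e' he' _; lra].
by exists e; split=> // y hy; apply: h => //; lra.
Qed.

(** Cardinality at most [K]. The list may contain points outside [P], so the bound passes to subsets
    at once. *)
Definition covered (K : nat) (P : R -> Prop) : Prop :=
  exists l : list R, (length l <= K)%N /\ forall y, P y -> List.In y l.

Definition finite_set (P : R -> Prop) : Prop :=
  exists l : list R, forall y, P y -> List.In y l.

(** * One variable: germs, boundaries, definable infima, generic continuity *)

Section OneVariable.
Context {OM : omin}.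

(** Having a decided germ to the right of [a] is preserved by Boolean operations and holds for
    points and half-lines, from which o-minimality builds every definable set. *)
Lemma germ_right (P : R -> Prop) (a : R) : Def P ->
  exists d, 0 < d /\ ((forall x, a < x < a + d -> P x) \/ (forall x, a < x < a + d -> ~ P x)).
Proof.
pose decided (P : R -> Prop) := exists d, 0 < d /\
  ((forall x, a < x < a + d -> P x) \/ (forall x, a < x < a + d -> ~ P x)).
have decide_or (X Y : R -> Prop) : decided X -> decided Y -> decided (fun x => X x \/ Y x).
  move=> [d1 [hd1 h1]] [d2 [hd2 h2]].
  exists (Rmin d1 d2); split; first exact: Rmin_glb_lt.
  have [m1 m2] := (Rmin_l d1 d2, Rmin_r d1 d2).
  case: h1 => h1; first by left=> x hx; left; apply: h1; lra.
  case: h2 => h2; first by left=> x hx; right; apply: h2; lra.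
  by right=> x hx [hX|hX]; [apply: (h1 x)|apply: (h2 x)] => //; lra.
have decide_ext (X Y : R -> Prop) : (forall x, X x <-> Y x) -> decided X -> decided Y.
  move=> h [d [hd H]]; exists d; split=> //.
  by case: H => H; [left|right] => x hx; rewrite -h; apply: H.
have decide_none : decided (fun _ => False) by exists 1; split; [lra|right=> x _ []].
have decide_pt p : decided (fun x => p = x).
  case: (Rlt_dec a p) => h; [exists (p - a)|exists 1]; split; try lra.
    by right=> x; lra.
  by right=> x; lra.
have decide_gt u : decided (fun x => u < x).
  case: (Rlt_dec a u) => h; [exists (u - a)|exists 1]; split; try lra.
    by right=> x; lra.
  by left=> x; lra.
have decide_not (X : R -> Prop) : decided X -> decided (fun x => ~ X x).
  move=> [d [hd [h|h]]]; exists d; split=> //; [right|left] => x hx; last exact: h.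
  by move=> hX; apply: hX; exact: h.
have decide_lt u : decided (fun x => x < u).
  refine (decide_ext _ _ _ (decide_not _ (decide_or _ _ (decide_gt u) (decide_pt u)))) => x.
  by split; lra.
have decide_true : decided (fun _ => True) by exists 1; split; [lra|left].
have decide_iv iv : decided (in_interval iv).
  have h1 : decided (fun x => match fst iv with Some a => a < x | None => True end).
    by case: (iv.1) => //.
  have h2 : decided (fun x => match snd iv with Some b => x < b | None => True end).
    by case: (iv.2) => //.
  refine (decide_ext _ _ _ (decide_not _ (decide_or _ _ (decide_not _ h1) (decide_not _ h2)))) => x.
  rewrite /in_interval; tauto.
move=> /(om_omin _ dsetP) [pts [ivs h]].
apply (decide_ext _ _ (fun x => iff_sym (h x))).
apply decide_or.
  elim: pts {h} => [|p pts IH] //=; exact (decide_or _ _ (decide_pt p) IH).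
elim: ivs {h} => [|iv ivs IH] /=.
  by refine (decide_ext _ _ _ decide_none) => x; split=> // -[iv []].
refine (decide_ext _ _ _ (decide_or _ _ (decide_iv iv) IH)) => x; split.
  by case=> [hx|[j [hj hx]]]; [exists iv; split; [left|]|exists j; split; [right|]].
by move=> [j [[<-|hj] hx]]; [left|right; exists j].
Qed.

Lemma sub_interval (P : R -> Prop) (a b : R) : Def P -> a < b ->
  exists a' b', [/\ a < a', a' < b', b' < b &
    (forall x, a' < x < b' -> P x) \/ (forall x, a' < x < b' -> ~ P x)].
Proof.
move=> hP hab; have [d [hd h]] := germ_right P a hP.
pose m := Rmin d (b - a).
have [m1 m2] := (Rmin_l d (b - a), Rmin_r d (b - a)).
have m0 : 0 < m by apply: Rmin_glb_lt; lra.
exists (a + m / 3), (a + m / 2); rewrite -/m in m1 m2; split; try lra.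
by case: h => h; [left|right] => x hx; apply: h; lra.
Qed.

Lemma finite_or_interval (P : R -> Prop) : Def P ->
  finite_set P \/ exists a b, a < b /\ forall x, a < x < b -> P x.
Proof.
move=> hP; case: (classic (exists a b, a < b /\ forall x, a < x < b -> P x)); first by right.
move=> hn; left; have [pts [ivs h]] := om_omin _ (@dsetP OM) _ hP.
exists pts => y hy; have /h [] // : P y by [].
move=> [[u v] [hiv [/= h1 h2]]]; case: hn.
have [u' [hu' hu]] : exists u', u' < y /\ forall x, u' < x -> match u with Some a => a < x | None => True end.
  case: u {hiv} h1 => [u|] h1; first by exists u.
  by exists (y - 1); split; [lra|].
have [v' [hv' hv]] : exists v', y < v' /\ forall x, x < v' -> match v with Some a => x < a | None => True end.
  case: v {hiv} h2 => [v|] h2; first by exists v.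
  by exists (y + 1); split; [lra|].
exists u', v'; split=> [|x hx]; first lra.
have : P ((fun _ : 'I_1 => x) ord0); last by [].
apply/h; right; exists (u, v); split=> //; split; [apply: hu|apply: hv]; lra.
Qed.

Definition bdry (P : R -> Prop) (y : R) : Prop :=
  forall e, 0 < e -> (exists y1, Rabs (y1 - y) < e /\ P y1) /\
                     (exists y2, Rabs (y2 - y) < e /\ ~ P y2).

(** An infinite boundary would contain an interval; on a subinterval [P] is constant, and its
    midpoint is then no boundary point. *)
Lemma bdry_finite (P : R -> Prop) : Def P -> finite_set (bdry P).
Proof.
move=> hP; have hB : Def (bdry P) by rewrite /bdry; definability.
case: (finite_or_interval _ hB) => // -[a [b [hab h]]].
have [a' [b' [h1 h2 h3 H]]] := sub_interval P a b hP hab.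
have hm : a < (a' + b') / 2 < b by lra.
have he : 0 < (b' - a') / 2 by lra.
have [[y1 [hy1 hP1]] [y2 [hy2 hP2]]] := h _ hm _ he.
move/Rabs_def2: hy1 => hy1; move/Rabs_def2: hy2 => hy2.
by case: H => H; [case: (hP2 (H y2 _))|case: (H y1 _ hP1)]; lra.
Qed.

Lemma bdry_free_const (P : R -> Prop) (a b : R) :
  (forall y, a <= y <= b -> ~ bdry P y) -> a <= b -> (P a <-> P b).
Proof.
move=> h; apply: interval_connected => x hx.
have [e he] := not_all_ex_not _ _ (h x hx).
have [e0 he'] := imply_to_and _ _ he.
exists e; split=> // y hy; have x0 : Rabs (x - x) < e by rewrite Rminus_diag Rabs_R0.
case: (not_and_or _ _ he') => hn.
  by split=> hP; case: hn; [exists y|exists x].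
by split=> hP; apply: NNPP => hN; case: hn; [exists x|exists y].
Qed.

(** Being the infimum is a first-order condition with at most one solution, so picking a solution by
    [epsilon] has a definable graph. Where there is no infimum the value is 0, which keeps [m]
    total. *)
Lemma def_inf {T} {sT : space T} (P : T * R -> Prop) : Def P ->
  exists m : T -> R, dmap m /\
    forall t, (exists y, P (t, y)) -> (exists c, forall y, P (t, y) -> c <= y) ->
      (forall y, P (t, y) -> m t <= y) /\
      (forall e, 0 < e -> exists y, P (t, y) /\ y < m t + e).
Proof.
move=> hP.
pose isinf t z := (forall y, P (t, y) -> z <= y) /\
  (forall e, 0 < e -> exists y, P (t, y) /\ y < z + e).
have uniq t z z' : isinf t z -> isinf t z' -> z = z'.
  move=> [h1 h2] [h1' h2'].
  apply: Rle_antisym; apply: Rnot_lt_le => hlt.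
    by have [|y [/h1 hy ?]] := h2' (z - z'); lra.
  by have [|y [/h1' hy ?]] := h2 (z' - z); lra.
have hd : Def (fun p : T * R => isinf p.1 p.2) by rewrite /isinf; definability.
pose m t := if excluded_middle_informative (exists z, isinf t z)
            then epsilon (inhabits 0) (isinf t) else 0.
have mE t : (exists z, isinf t z) -> isinf t (m t).
  by rewrite /m; case: excluded_middle_informative => //= h _; exact: epsilon_spec.
exists m; split.
  apply: (dmap_graph _ (fun t z => isinf t z \/ (~ (exists z, isinf t z) /\ z = 0))).
    move=> t z; split.
      case=> [h|[h ->]]; first by apply: (uniq t) => //; apply: mE; exists z.
      by rewrite /m; case: excluded_middle_informative.
    move=> <-; case: (classic (exists z, isinf t z)) => h; [left|right; split=> //].
      exact: mE.
    by rewrite /m; case: excluded_middle_informative.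
  by rewrite /isinf; definability.
move=> t [y0 hy0] [c hc]; apply: mE.
have [M [ub lub]] : {M | is_lub (fun z => P (t, - z)) M}.
  apply: completeness; last by exists (- y0); rewrite Ropp_involutive.
  by exists (- c) => z /hc; lra.
exists (- M); split=> [y hy|e he].
  by have := ub (- y); rewrite Ropp_involutive => /(_ hy); lra.
apply: NNPP => hn; have : M <= M - e; last lra.
apply: lub => z hz; apply: Rnot_lt_le => hlt; apply: hn.
by exists (- z); split=> //; lra.
Qed.

Definition cont_at (phi : R -> R) (s : R) : Prop :=
  forall e, 0 < e -> exists d, 0 < d /\
    forall s', Rabs (s' - s) < d -> Rabs (phi s' - phi s) < e.

(* Bisecting the range and shrinking the domain accordingly leads to a point
   where the oscillation vanishes. *)
Lemma cont_dense (phi : R -> R) (a b M : R) : dmap phi ->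
  (forall s, Rabs (phi s) <= M) -> a < b ->
  exists s, a < s < b /\ cont_at phi s.
Proof.
move=> hphi hM hab.
pose Inv (q : (R * R) * (R * R)) := q.1.1 < q.1.2 /\
  forall x, q.1.1 < x < q.1.2 -> q.2.1 <= phi x <= q.2.2.
have step q : exists q', Inv q -> Inv q' /\
    [/\ q.1.1 < q'.1.1, q'.1.2 < q.1.2 & q'.2.2 - q'.2.1 = (q.2.2 - q.2.1) / 2].
  case: (classic (Inv q)) => [[h1 h2]|]; last by exists q.
  have hd : Def (fun x => phi x <= (q.2.1 + q.2.2) / 2) by definability.
  have [a' [b' [k1 k2 k3 H]]] := sub_interval _ _ _ hd h1.
  case: H => H; [exists ((a', b'), (q.2.1, (q.2.1 + q.2.2) / 2))|
                 exists ((a', b'), ((q.2.1 + q.2.2) / 2, q.2.2))] => _;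
    (split; [split=> //= x hx; have := H x hx; have := h2 x; lra|by split=> //=; field]).
have [F hF] := choice _ step.
pose q n := Nat.iter n F ((a, b), (- M, M)).
have Iq n : Inv (q n).
  elim: n => [|n IH]; last by case: (hF _ IH).
  by split=> //= x _; exact: Rabs_le_bounds.
have qS n : [/\ (q n).1.1 < (q n.+1).1.1, (q n.+1).1.2 < (q n).1.2 &
    (q n.+1).2.2 - (q n.+1).2.1 = ((q n).2.2 - (q n).2.1) / 2].
  by case: (hF _ (Iq n)).
have mono n k : (q n).1.1 <= (q (k + n)%N).1.1 /\ (q (k + n)%N).1.2 <= (q n).1.2.
  elim: k => [|k IH]; first by rewrite add0n; lra.
  by rewrite addSn; have [] := qS (k + n)%N; lra.
have cross n m : (q n).1.1 < (q m).1.2.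
  have [h1 _] := mono n m; have [_ h2] := mono m n.
  by have [h3 _] := Iq (m + n)%N; rewrite addnC in h2; lra.
have [x [ub lub]] : {x | is_lub (fun y => exists n, y = (q n).1.1) x}.
  apply: completeness; last by exists (q 0%N).1.1, 0%N.
  by exists (q 0%N).1.2 => y [n ->]; apply: Rlt_le.
have hl n : (q n).1.1 < x.
  have [h _ _] := qS n; apply: Rlt_le_trans h _; apply: ub; by exists n.+1.
have hr n : x < (q n).1.2.
  have [_ h _] := qS n; apply: Rle_lt_trans h; apply: lub => y [m ->].
  exact: Rlt_le.
have width n : (q n).2.2 - (q n).2.1 = 2 * M * (/ 2) ^ n.
  elim: n => [|n IH] /=; first by lra.
  by have [_ _] := qS n; rewrite IH /= => ->; field.
exists x; split; first by have := hl 0%N; have := hr 0%N; rewrite /=; lra.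
move=> e he; have hh : 0 <= / 2 < 1 by lra.
have [n hn] := geometric_small (2 * M) _ e hh he.
exists (Rmin (x - (q n).1.1) ((q n).1.2 - x)); split.
  by apply: Rmin_glb_lt; have := hl n; have := hr n; lra.
move=> y hy; have h1 := Rlt_le_trans _ _ _ hy (Rmin_l _ _).
have h2 := Rlt_le_trans _ _ _ hy (Rmin_r _ _).
move/Rabs_def2: h1 => h1; move/Rabs_def2: h2 => h2.
have [_ I] := Iq n; have hx := I x (conj (hl n) (hr n)).
have hy' : (q n).1.1 < y < (q n).1.2 by lra.
have := I y hy'; rewrite -(width n) in hn.
by move=> ?; apply: Rabs_def1; lra.
Qed.

(** The continuity points form a definable set, so some subinterval lies inside it or misses it;
    density excludes the latter. *)
Lemma cont_sub_interval (phi : R -> R) (a b M : R) : dmap phi ->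
  (forall s, Rabs (phi s) <= M) -> a < b ->
  exists a' b', [/\ a < a', a' < b', b' < b & forall s, a' < s < b' -> cont_at phi s].
Proof.
move=> hphi hM hab.
have hd : Def (cont_at phi) by rewrite /cont_at; definability.
have [a' [b' [h1 h2 h3 [H|H]]]] := sub_interval _ _ _ hd hab.
  by exists a', b'.
by have [s [hs /(H _ hs)]] := cont_dense phi a' b' M hphi hM h2.
Qed.

End OneVariable.

(** * Uniform finiteness *)

Lemma covered_rel (K : nat) (P P' : R -> Prop) (rel : R -> R -> Prop) :
  (forall y', P' y' -> exists y, [/\ P y, rel y y' &
    forall y'', P' y'' -> rel y y'' -> y'' = y']) ->
  covered K P -> covered K P'.
Proof.
move=> h [l [hl hP]].
pose phi y := epsilon (inhabits 0) (fun y' => P' y' /\ rel y y').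
exists (List.map phi l); split; first by rewrite length_map.
move=> y' hy'; have [y [hy hr hu]] := h y' hy'.
apply/List.in_map_iff; exists y; split; last exact: hP.
have [h1 h2] : P' (phi y) /\ rel y (phi y).
  by apply: (epsilon_spec (inhabits 0) (fun y' => P' y' /\ rel y y')); exists y'.
exact: hu.
Qed.

Lemma covered_le K K' P : (K <= K')%N -> covered K P -> covered K' P.
Proof. by move=> hK [l [hl h]]; exists l; split=> //; lia. Qed.

(* Over points near [s], the fibres of [D] correspond bijectively to the fibre at [s]. *)
Definition match_at (D : R * R -> Prop) (s : R) : Prop :=
  exists e, 0 < e /\ exists d, 0 < d /\ forall s', Rabs (s' - s) < d ->
    (forall y, D (s, y) -> exists y', D (s', y') /\ Rabs (y' - y) < e /\
       forall y'', D (s', y'') -> Rabs (y'' - y) < e -> y'' = y') /\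
    (forall y', D (s', y') -> exists y, D (s, y) /\ Rabs (y' - y) < e /\
       forall y'', D (s, y'') -> Rabs (y' - y'') < e -> y'' = y).

Lemma match_covered (D : R * R -> Prop) (s : R) : match_at D s ->
  exists d, 0 < d /\ forall s', Rabs (s' - s) < d ->
    forall K, covered K (fun y => D (s', y)) <-> covered K (fun y => D (s, y)).
Proof.
move=> [e [he [d [hd h]]]]; exists d; split=> // s' hs'; have [h1 h2] := h s' hs'.
move=> K; split.
  apply: (covered_rel _ _ _ (fun y y' => Rabs (y - y') < e)) => y hy.
  have [y' [hy' [hn _]]] := h1 y hy; exists y'; split=> // y'' hy'' hn''.
  by have [y0 [_ [_ hu]]] := h2 y' hy'; rewrite (hu y) // (hu y'').
apply: (covered_rel _ _ _ (fun y y' => Rabs (y' - y) < e)) => y' hy'.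
have [y [hy [hn _]]] := h2 y' hy'; exists y; split=> // y'' hy'' hn''.
by have [y0 [_ [_ hu]]] := h1 y hy; rewrite (hu y') // (hu y'').
Qed.

(** Near [(s, y)], [D] is either the graph of a function continuous at [s], or empty. This is the
    pointwise counterpart of [match_at]. *)
Definition normal_pt (D : R * R -> Prop) (s y : R) : Prop :=
  (D (s, y) -> exists e0, 0 < e0 /\ forall e, 0 < e <= e0 ->
     exists d, 0 < d /\ forall s', Rabs (s' - s) < d ->
       exists y', D (s', y') /\ Rabs (y' - y) < e /\
         forall y'', D (s', y'') -> Rabs (y'' - y) < e -> y'' = y') /\
  (~ D (s, y) -> exists e, 0 < e /\ exists d, 0 < d /\
     forall s', Rabs (s' - s) < d -> forall y', D (s', y') -> ~ Rabs (y' - y) < e).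

(** Normality at the finitely many points over [s] gives each of them exactly one partner in nearby
    fibres. Compactness of [[-1, 1]] prevents further points from appearing elsewhere, and [e], at
    most half the gap in the fibre, makes partners unique in the other direction. *)
Lemma normal_match (D : R * R -> Prop) (s : R) :
  (forall s y, D (s, y) -> -1 <= y <= 1) ->
  finite_set (fun y => D (s, y)) ->
  (forall y, -1 <= y <= 1 -> normal_pt D s y) -> match_at D s.
Proof.
move=> hb [l hl] hN.
pose one e y s' := exists y', D (s', y') /\ Rabs (y' - y) < e /\
         forall y'', D (s', y'') -> Rabs (y'' - y) < e -> y'' = y'.
have [e1 [he1 h1]] : exists e, 0 < e /\ forall e', 0 < e' <= e -> forall y, List.In y l ->
    D (s, y) -> exists d, 0 < d /\ forall s', Rabs (s' - s) < d -> one e' y s'.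
  apply: (list_min_pos l (fun y e' => D (s, y) -> exists d, 0 < d /\
    forall s', Rabs (s' - s) < d -> one e' y s')) => y _.
  case: (classic (D (s, y))) => hD; last by exists 1; split; [lra|move=> e' _ /hD].
  by have [/(_ hD) [e0 [he0 H]] _] := hN y (hb _ _ hD); exists e0; split=> // e' he' _; apply: H.
have [e2 [he2 h2]] : exists e, 0 < e /\ forall e', 0 < e' <= e -> forall y, List.In y l ->
    forall y', List.In y' l -> y' <> y -> e' <= Rabs (y' - y).
  apply: (list_min_pos l (fun y e' => forall y', List.In y' l -> y' <> y -> e' <= Rabs (y' - y))).
  move=> y _; have [e [he H]] := list_gap l y; exists e; split=> // e' he' y' hy' hne.
  by have := H y' hy' hne; lra.
pose e := Rmin e1 (e2 / 2).
have [m1 m2] := (Rmin_l e1 (e2 / 2), Rmin_r e1 (e2 / 2)).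
have he : 0 < e by apply: Rmin_glb_lt; lra.
rewrite -/e in m1 m2.
have [d1 [hd1 k1]] : exists d, 0 < d /\ forall d', 0 < d' <= d -> forall y, List.In y l ->
    D (s, y) -> forall s', Rabs (s' - s) < d' -> one e y s'.
  apply: (list_min_pos l (fun y d' => D (s, y) -> forall s', Rabs (s' - s) < d' -> one e y s')).
  move=> y hy.
  case: (classic (D (s, y))) => hD; last by exists 1; split; [lra|move=> e' _ /hD].
  have [d [hd H]] := h1 e (conj he m1) y hy hD; exists d; split=> // d' hd' _ s' hs'.
  by apply: H; lra.
have [d2 [hd2 k2]] : exists d, 0 < d /\ forall s', Rabs (s' - s) < d ->
    forall y', -1 <= y' <= 1 -> D (s', y') -> exists y, D (s, y) /\ Rabs (y' - y) < e.
  apply: (interval_compact (fun X => exists d, 0 < d /\ forall s', Rabs (s' - s) < d ->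
    forall y', X y' -> D (s', y') -> exists y, D (s, y) /\ Rabs (y' - y) < e)).
  - move=> X Y hXY [d [hd H]]; exists d; split=> // s' hs' y' hy'.
    by apply: H => //; exact: hXY.
  - move=> X Y [d [hd H]] [d' [hd' H']]; exists (Rmin d d'); split.
      exact: Rmin_glb_lt.
    have [n1 n2] := (Rmin_l d d', Rmin_r d d').
    by move=> s' hs' y' [hy'|hy']; [apply: H|apply: H'] => //; lra.
  - move=> y hy; case: (classic (D (s, y))) => hD.
      by exists e; split=> //; exists 1; split; [lra|move=> s' _ y' hy' _; exists y].
    have [_ /(_ hD) [e' [he' [d [hd H]]]]] := hN y hy.
    exists e'; split=> //; exists d; split=> // s' hs' y' hy' hD'.
    by case: (H s' hs' y' hD').
  - lra.
exists e; split=> //; exists (Rmin d1 d2); split; first exact: Rmin_glb_lt.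
have [n1 n2] := (Rmin_l d1 d2, Rmin_r d1 d2).
move=> s' hs'; split=> [y hy|y' hy'].
  by apply: (k1 d1) => //; [lra|exact: hl|lra].
have [|y [hy hn]] := k2 s' _ y' (hb _ _ hy') hy'; first lra.
exists y; split=> //; split=> // y'' hy'' hn''.
apply: NNPP => hne; have he2' : 0 < e2 <= e2 by lra.
have := h2 e2 he2' y (hl _ hy) y'' (hl _ hy'') hne.
move/Rabs_def2: hn => hn; move/Rabs_def2: hn'' => hn'' hge.
by have : Rabs (y'' - y) < e2; [apply: Rabs_def1|]; lra.
Qed.

Section Finiteness.
Context {OM : omin}.

(** Putting [M] into every fibre makes the infimum exist everywhere; the value [M] then stands for
    an empty fibre. *)
Lemma def_inf_bounded {T} {sT : space T} (P : T * R -> Prop) (M : R) : Def P ->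
  (forall t y, P (t, y) -> - M <= y <= M) -> (forall t, P (t, M)) ->
  exists m : T -> R, [/\ dmap m, forall t, Rabs (m t) <= M &
    forall t, (forall y, P (t, y) -> m t <= y) /\
      (forall e, 0 < e -> exists y, P (t, y) /\ y < m t + e)].
Proof.
move=> hP hb hM; have [m [dm Hm]] := def_inf P hP.
have {}Hm t : (forall y, P (t, y) -> m t <= y) /\
    (forall e, 0 < e -> exists y, P (t, y) /\ y < m t + e).
  by apply: Hm; [exists M|exists (- M) => y /hb; lra].
exists m; split=> // t; have [H1 H2] := Hm t; apply: Rabs_le; split; last exact: H1.
by apply: Rnot_lt_le => hlt; have [|y [/hb hy ?]] := H2 (- M - m t); lra.
Qed.

(* If the exceptional set contained an interval, consider the lowest abnormal
   level [beta s] over it and the points of [D] directly below and above: where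
   these three functions are continuous, the levels near [beta s] are normal. *)
Lemma match_finite (D : R * R -> Prop) : Def D ->
  (forall s y, D (s, y) -> -1 <= y <= 1) ->
  (forall s, finite_set (fun y => D (s, y))) ->
  finite_set (fun s => ~ match_at D s).
Proof.
move=> hD hb hfin.
have hZ : Def (fun s => ~ match_at D s) by rewrite /match_at; definability.
case: (finite_or_interval _ hZ) => // -[a [b [hab hbad]]].
(* The value 2 lies outside the band [[-1, 1]] that contains [D], so it cannot be mistaken for a
   genuine level. *)
have hB : Def (fun p : R * R => (-1 <= p.2 <= 1) /\ ~ normal_pt D p.1 p.2 \/ p.2 = 2).
  by rewrite /normal_pt; definability.
have [||beta [dbeta bbeta Hbeta]] := def_inf_bounded _ 2 hB.
- by move=> s y /=; lra.
- by move=> s; right.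
(* A supremum obtained as an infimum of the reflected set: the level below [beta s] is [- lo s]. *)
have hBl : Def (fun p : R * R => D (p.1, - p.2) /\ - p.2 < beta p.1 \/ p.2 = 2).
  by definability.
have [||lo [dlo blo Hlo]] := def_inf_bounded _ 2 hBl.
- by move=> s y /= [[/hb]|]; lra.
- by move=> s; right.
have hBh : Def (fun p : R * R => D p /\ beta p.1 < p.2 \/ p.2 = 2).
  by definability.
have [||hi [dhi bhi Hhi]] := def_inf_bounded _ 2 hBh.
- by move=> s y /= [[/hb]|]; lra.
- by move=> s; right.
have [a1 [b1 [? h1 ? c1]]] := cont_sub_interval _ _ _ _ dbeta bbeta hab.
have [a2 [b2 [? h2 ? c2]]] := cont_sub_interval _ _ _ _ dlo blo h1.
have [a3 [b3 [? h3 ? c3]]] := cont_sub_interval _ _ _ _ dhi bhi h2.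
have hin : Def (fun s => D (s, beta s)) by definability.
have [a4 [b4 [? h4 ? Hin]]] := sub_interval _ _ _ hin h3.
have [s0 Es0] : exists s, s = (a4 + b4) / 2 by exists ((a4 + b4) / 2).
have [y0 [hy0 nny0]] : exists y, -1 <= y <= 1 /\ ~ normal_pt D s0 y.
  apply: NNPP => hn; apply: (hbad s0); first by lra.
  apply: normal_match => // y hy; apply: NNPP => hnn; apply: hn; by exists y.
have hbeta1 : -1 <= beta s0 <= 1.
  have [H1 H2] := Hbeta s0; split; last by have := H1 y0 (or_introl (conj hy0 nny0)); lra.
  apply: Rnot_lt_le => hlt; have [|y [hy hy']] := H2 (-1 - beta s0); first lra.
  by move: hy hy' => /=; lra.
have [l hl] := hfin s0.
have [g [hg gap]] := list_gap l (beta s0).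
have lo_lt : - lo s0 < beta s0.
  have [_ H2] := Hlo s0; have [|y [[[/= hy hlt]|/= hy] hy']] := H2 (Rmin g 1).
  - by apply: Rmin_glb_lt; lra.
  - have hne : - y <> beta s0 by lra.
    have := gap _ (hl _ hy) hne; rewrite Rabs_left; last lra.
    by have := Rmin_l g 1; lra.
  - by have := Rmin_r g 1; lra.
have hi_gt : beta s0 < hi s0.
  have [_ H2] := Hhi s0; have [|y [[[/= hy hlt]|/= hy] hy']] := H2 (Rmin g 1).
  - by apply: Rmin_glb_lt; lra.
  - have hne : y <> beta s0 by lra.
    have := gap _ (hl _ hy) hne; rewrite Rabs_pos_eq; last lra.
    by have := Rmin_l g 1; lra.
  - by have := Rmin_r g 1; lra.
(* Half the distance from [beta s0] to the nearer of [- lo s0] and [hi s0]. When these two move by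
   less than [r], the only level of [D] that can lie within [r] of [beta s0] is [beta s]. *)
pose r := Rmin (beta s0 + lo s0) (hi s0 - beta s0) / 2.
have [r1 r2] := (Rmin_l (beta s0 + lo s0) (hi s0 - beta s0), Rmin_r (beta s0 + lo s0) (hi s0 - beta s0)).
have hr : 0 < r by rewrite /r; have := Rmin_glb_lt (beta s0 + lo s0) (hi s0 - beta s0) 0; lra.
have hs0 : a4 < s0 < b4 by lra.
have near e : 0 < e -> exists d, 0 < d /\ forall s, Rabs (s - s0) < d ->
    [/\ a4 < s < b4, Rabs (beta s - beta s0) < e &
        forall y, D (s, y) -> Rabs (y - beta s0) < r -> y = beta s].
  move=> he.
  have [|d1 [hd1 k1]] := c1 s0 _ e he; first lra.
  have [|d2 [hd2 k2]] := c2 s0 _ r hr; first lra.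
  have [|d3 [hd3 k3]] := c3 s0 _ r hr; first lra.
  pose d4 := (b4 - a4) / 2.
  exists (Rmin (Rmin d1 d2) (Rmin d3 d4)); split.
    by repeat apply: Rmin_glb_lt; rewrite /d4; lra.
  have := (Rmin_l (Rmin d1 d2) (Rmin d3 d4), Rmin_r (Rmin d1 d2) (Rmin d3 d4),
    Rmin_l d1 d2, Rmin_r d1 d2, Rmin_l d3 d4, Rmin_r d3 d4).
  move=> [[[[[m1 m2] m3] m4] m5] m6] s hs.
  have hd4 : Rabs (s - s0) < d4 by lra.
  move/Rabs_def2: hd4; rewrite /d4 => hd4.
  split; [lra|by apply: k1; lra|].
  move=> y hy /Rabs_def2 hyr.
  have /Rabs_def2 k2' : Rabs (lo s - lo s0) < r by apply: k2; lra.
  have /Rabs_def2 k3' : Rabs (hi s - hi s0) < r by apply: k3; lra.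
  have [Hl _] := Hlo s; have [Hh _] := Hhi s.
  have rr : 2 * r <= beta s0 + lo s0 /\ 2 * r <= hi s0 - beta s0.
    by rewrite /r; lra.
  case: (Rtotal_order y (beta s)) => [hlt|[//|hgt]].
    have := Hl (- y); rewrite /= Ropp_involutive => /(_ (or_introl (conj hy hlt))); lra.
  by have := Hh y (or_introl (conj hy hgt)); lra.
(* The infimum need not be attained, so the contradiction is sought at an abnormal level [y1] within
   [r] of [beta s0]. *)
have [_ H2] := Hbeta s0.
have [y1 [[[/= hy1 nny1]|/= hy1] hy1']] := H2 (Rmin r 1) (Rmin_glb_lt _ _ _ hr Rlt_0_1); last first.
  by have := Rmin_r r 1; lra.
have {}H2 : Rabs (y1 - beta s0) < r.
  have [H1 _] := Hbeta s0; have := H1 y1 (or_introl (conj hy1 nny1)).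
  by have := Rmin_l r 1; move=> ? ?; apply: Rabs_def1; lra.
case: nny1; split=> hy.
  have E : y1 = beta s0.
    by have [d [hd /(_ s0)]] := near 1 Rlt_0_1; rewrite Rminus_diag Rabs_R0 => /(_ hd) [_ _]; apply.
  have {}Hin : forall s, a4 < s < b4 -> D (s, beta s).
    by case: Hin => // Hin; case: (Hin s0 hs0); rewrite -E.
  exists r; split=> // e he; have [|d [hd H]] := near e; first lra.
  exists d; split=> // s' hs'; have [k1 k2 k3] := H s' hs'.
  exists (beta s'); rewrite E; split; first exact: Hin.
  by split=> // y'' hy'' hn; apply: k3 => //; lra.
case: Hin => Hin.
  have hne : y1 <> beta s0 by move=> E; apply: hy; rewrite E; apply: Hin.
  pose e := Rmin (Rabs (y1 - beta s0) / 2) (r - Rabs (y1 - beta s0)).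
  have hp : 0 < Rabs (y1 - beta s0) by apply: Rabs_pos_lt; lra.
  have [m1 m2] := (Rmin_l (Rabs (y1 - beta s0) / 2) (r - Rabs (y1 - beta s0)),
                   Rmin_r (Rabs (y1 - beta s0) / 2) (r - Rabs (y1 - beta s0))).
  have he : 0 < e by apply: Rmin_glb_lt; lra.
  exists e; split=> //; have [|d [hd H]] := near (Rabs (y1 - beta s0) / 2); first lra.
  exists d; split=> // s' hs' y' hy' hn; have [k1 k2 k3] := H s' hs'.
  rewrite -/e in m1 m2.
  have tri := Rabs_triang (y' - y1) (y1 - beta s0).
  have E1 : y' - y1 + (y1 - beta s0) = y' - beta s0 by ring.
  rewrite E1 in tri; have E : y' = beta s' by apply: k3 => //; lra.
  rewrite E in hn.
  have tri' := Rabs_triang (beta s' - beta s0) (- (beta s' - y1)).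
  have E2 : beta s' - beta s0 + - (beta s' - y1) = y1 - beta s0 by ring.
  by rewrite E2 Rabs_Ropp in tri'; lra.
exists (r - Rabs (y1 - beta s0)); split; first lra.
have [d [hd H]] := near 1 Rlt_0_1; exists d; split=> // s' hs' y' hy' hn.
have [k1 k2 k3] := H s' hs'.
have tri := Rabs_triang (y' - y1) (y1 - beta s0).
have E1 : y' - y1 + (y1 - beta s0) = y' - beta s0 by ring.
rewrite E1 in tri; have E : y' = beta s' by apply: k3 => //; lra.
by apply: (Hin s' k1); rewrite -E.
Qed.

End Finiteness.

Lemma snoc_init n (z : Rn n.+1) : snoc (init z) (z ord_max) = z.
Proof.
apply: functional_extensionality => i; rewrite /snoc /init.
case: unliftP => [j ->|-> //]; congr z; apply: val_inj => /=.
by have hj : (j < n)%N := ltn_ord j; rewrite /bump leqNgt hj.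
Qed.

Lemma init_snoc n (y : Rn n) t : init (snoc y t) = y.
Proof.
apply: functional_extensionality => i; rewrite /snoc /init.
case: unliftP => [j E|E].
  congr y; apply: val_inj; move: (f_equal val E) => /= ->.
  by have hj : (j < n)%N := ltn_ord j; rewrite /bump leqNgt hj.
by have hi := ltn_ord i; move: (f_equal val E) => /= E'; lia.
Qed.

Lemma snoc_last n (y : Rn n) t : snoc y t ord_max = t.
Proof. by rewrite /snoc unlift_none. Qed.

Lemma bounded_uniformly (Q : nat -> nat -> Prop) (n : nat) :
  (forall i M M', (M <= M')%N -> Q i M -> Q i M') ->
  (forall i, (i < n)%N -> exists M, Q i M) ->
  exists M, forall i, (i < n)%N -> Q i M.
Proof.
move=> mono; elim: n => [|n IH] h; first by exists 0%N.
have [|M hM] := IH; first by move=> i hi; apply: h; lia.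
have [M' hM'] := h n (ltnSn n).
exists (M + M')%N => i hi; case: (ltnP i n) => hin.
  by apply: mono (hM i hin); lia.
have -> : i = n by lia.
by apply: mono hM'; lia.
Qed.

Lemma below_neighbour (V : nat -> R) (K : nat) (s : R) :
  (forall i, (i < K)%N -> V i <> s) ->
  (forall i, (i < K)%N -> s < V i) \/
  exists i, [/\ (i < K)%N, V i < s & forall j, (j < K)%N -> V j <= V i \/ s < V j].
Proof.
elim: K => [|K IH] h; first by left.
have hK := h K (ltnSn K).
have [|hl|[i [hi hs hj]]] := IH; first by move=> i hi; apply: h; lia.
  case: (Rlt_dec s (V K)) => hsK.
    left=> i hi; case: (ltnP i K) => hin; first exact: hl.
    by have -> : i = K by lia.
  right; exists K; split; [lia|lra|] => j hj; case: (ltnP j K) => hin; first by right; exact: hl.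
  have -> : j = K by lia.
  by left; lra.
case: (Rlt_dec s (V K)) => hsK; [|case: (Rle_dec (V K) (V i)) => hKi].
- right; exists i; split=> //; first lia.
  move=> j hjK; case: (ltnP j K) => hin; first exact: hj.
  have -> : j = K by lia.
  by right.
- right; exists i; split=> //; first lia.
  move=> j hjK; case: (ltnP j K) => hin; first exact: hj.
  have -> : j = K by lia.
  by left.
right; exists K; split; [lia|lra|].
move=> j hjK; case: (ltnP j K) => hin; last first.
  have -> : j = K by lia.
  by left; lra.
by case: (hj j hin) => ?; [left; lra|right].
Qed.

Lemma above_neighbour (V : nat -> R) (K : nat) (s : R) :
  (forall i, (i < K)%N -> V i <> s) ->
  (forall i, (i < K)%N -> V i < s) \/
  exists i, [/\ (i < K)%N, s < V i & forall j, (j < K)%N -> V i <= V j \/ V j < s].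
Proof.
move=> h; have [|H|[i [hi hs H]]] := below_neighbour (fun i => - V i) K (- s).
- by move=> i /h; lra.
- by left=> i /H; lra.
- by right; exists i; split=> //; [lra|move=> j /H; lra].
Qed.

(** Candidates for one point in each piece into which the values of [V] cut the line: no value at
    all, a value itself, beyond the largest, before the smallest, between two neighbours. *)
Definition sample (V : nat -> R) (k i j : nat) : R :=
  match k with
  | 0%N => 0
  | 1%N => V i
  | 2%N => V i + 1
  | 3%N => V i - 1
  | _ => (V i + V j) / 2
  end.

(** The bound [K.+1] on indices leaves room for the dummy index 0 when [K] is 0. *)
Lemma sample_reaches (V : nat -> R) (K : nat) (s : R) :
  exists k i j, [/\ (k < 5)%N, (i < K.+1)%N, (j < K.+1)%N &
    sample V k i j = s \/
    forall l, (l < K)%N -> ~ (Rmin (sample V k i j) s <= V l <= Rmax (sample V k i j) s)].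
Proof.
case: (classic (exists i, (i < K)%N /\ V i = s)) => [[i [hi hs]]|hn].
  by exists 1%N, i, 0%N; split=> //; [lia|left].
have hne i : (i < K)%N -> V i <> s by move=> hi hs; apply: hn; exists i.
have minmax (x y z : R) : Rmin x y <= z <= Rmax x y -> x <= z <= y \/ y <= z <= x.
  by rewrite /Rmin /Rmax; case: Rle_dec => h; lra.
case: (below_neighbour V K s hne) => [hl|[i [hi his Hi]]];
  case: (above_neighbour V K s hne) => [hu|[j [hj hjs Hj]]].
- exists 0%N, 0%N, 0%N; split=> //; right=> l hlK _.
  by have := hl l hlK; have := hu l hlK; lra.
- exists 3%N, j, 0%N; split=> //; [lia|right=> l hlK /minmax /=].
  by have := hl l hlK; case: (Hj l hlK); lra.
- exists 2%N, i, 0%N; split=> //; [lia|right=> l hlK /minmax /=].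
  by have := hu l hlK; case: (Hi l hlK); lra.
exists 4%N, i, j; split=> //; [lia|lia|right=> l hlK /minmax /=].
by case: (Hi l hlK); case: (Hj l hlK); lra.
Qed.

Lemma finite_lower_bound (P : R -> Prop) : finite_set P ->
  exists c, forall y, P y -> c <= y.
Proof.
move=> [l hl].
have [c hc] : exists c, forall y, List.In y l -> c <= y.
  elim: l {hl} => [|a l [c hc]]; first by exists 0.
  exists (Rmin a c) => y [<-|/hc h]; first exact: Rmin_l.
  by have := Rmin_r a c; lra.
by exists c => y /hl /hc.
Qed.

(** * Uniform finiteness, by induction on the number of parameters *)

Section UniformFiniteness.
Context {OM : omin}.

(** A nonempty finite fibre contains its infimum, which is definable; removing it lowers the bound
    by one. Indices are stored as reals so that a single definable map enumerates all fibres. *)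
Lemma bounded_enum {T} {sT : space T} (P : T * R -> Prop) (K : nat) : Def P ->
  (forall t, covered K (fun y => P (t, y))) ->
  exists e : T * R -> R, dmap e /\
    forall t y, P (t, y) -> exists i : nat, (i < K)%N /\ e (t, INR i) = y.
Proof.
elim: K P => [|K IH] P hP hK.
  exists (fun _ => 0); split; first exact: dmap_cst.
  move=> t y hy; have [l [hl /(_ y hy)]] := hK t.
  by case: l hl.
have [m [dm Hm]] := def_inf P hP.
have hm t y : P (t, y) -> P (t, m t).
  move=> hy; have [l [_ hl]] := hK t.
  have [||H1 H2] := Hm t; first by exists y.
    by apply: finite_lower_bound; exists l.
  have [g [hg gap]] := list_gap l (m t).
  have [z [hz hzm]] := H2 g hg; case: (Req_dec z (m t)) => [<- //|hne].
  have := gap z (hl z hz) hne; rewrite Rabs_pos_eq; last by have := H1 z hz; lra.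
  by lra.
have hP' : Def (fun p => P p /\ p.2 <> m p.1) by definability.
have [|e [de he]] := IH _ hP'.
  move=> t; have [l [hl hlP]] := hK t.
  case: (classic (exists y, P (t, y))) => [[y0 hy0]|hn]; last first.
    by exists nil; split=> // y [hy _]; case: hn; exists y.
  exists (List.remove Req_EM_T (m t) l); split.
    have := List.remove_length_lt Req_EM_T l (m t) (hlP _ (hm t y0 hy0)); lia.
  by move=> y [/= hy hne]; apply: List.in_in_remove => //; exact: hlP.
exists (fun p => if excluded_middle_informative (p.2 = INR K) then m p.1 else e p).
split; first by definability.
move=> t y hy; case: (Req_dec y (m t)) => hym.
  by exists K; split=> //; case: excluded_middle_informative.
have [i [hi <-]] := he t y (conj hy hym).
exists i; split; first lia.
by case: excluded_middle_informative => //= /INR_eq E; lia.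
Qed.

Definition uniformly_finite T {sT : space T} : Prop :=
  forall P : T * R -> Prop, Def P -> (forall t, finite_set (fun y => P (t, y))) ->
  exists K, forall t, covered K (fun y => P (t, y)).

(* The fibre cardinality is constant between consecutive exceptional points, which
   are uniformly finite in number, so it suffices to bound it at finitely many
   definable sample points. *)
Lemma uniformly_finite_prod_bounded {T} {sT : space T} (P : (T * R) * R -> Prop) :
  uniformly_finite T -> Def P -> (forall t y, P (t, y) -> -1 <= y <= 1) ->
  (forall t, finite_set (fun y => P (t, y))) ->
  exists K, forall t, covered K (fun y => P (t, y)).
Proof.
move=> UF hP hb hfin.
pose Z (p : T * R) := ~ match_at (fun q => P ((p.1, q.1), q.2)) p.2.
have hZ : Def Z by rewrite /Z /match_at /=; definability.
have [|K1 hK1] := UF Z hZ.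
  move=> r; apply: (match_finite (fun q => P ((r, q.1), q.2))) => [|s y|s].
  - by definability.
  - exact: hb.
  - exact (hfin (r, s)).
have [e [de he]] := bounded_enum Z K1 hZ hK1.
pose V r i := e (r, INR i).
pose smp k i j r := sample (V r) k i j.
have dsmp k i j : dmap (smp k i j).
  by rewrite /smp /V /sample; case: k => [|[|[|[|k]]]]; definability.
(* Restricted to the graph of one sample function, the fibres are indexed by [T] alone, where the
   induction hypothesis applies. *)
have bnd k i j : exists K, forall r, covered K (fun y => P ((r, smp k i j r), y)).
  apply: (UF (fun p => P ((p.1, smp k i j p.1), p.2))); last by move=> r; exact (hfin (r, smp k i j r)).
  by have := dsmp k i j; set f := smp k i j => df; definability.
have mono (Q : T -> R) M M' : (M <= M')%N -> (forall r, covered M (fun y => P ((r, Q r), y))) ->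
    forall r, covered M' (fun y => P ((r, Q r), y)).
  by move=> hM h r; apply: covered_le hM (h r).
have [K hK] : exists K, forall k, (k < 5)%N -> forall i, (i < K1.+1)%N ->
    forall j, (j < K1.+1)%N -> forall r, covered K (fun y => P ((r, smp k i j r), y)).
  apply: (bounded_uniformly (fun k M => forall i, (i < K1.+1)%N ->
    forall j, (j < K1.+1)%N -> forall r, covered M (fun y => P ((r, smp k i j r), y)))).
    by move=> k M M' hM h i hi j hj; apply: mono hM (h i hi j hj).
  move=> k _; apply: (bounded_uniformly (fun i M =>
    forall j, (j < K1.+1)%N -> forall r, covered M (fun y => P ((r, smp k i j r), y)))).
    by move=> i M M' hM h j hj; apply: mono hM (h j hj).
  move=> i _; apply: (bounded_uniformly (fun j M =>
    forall r, covered M (fun y => P ((r, smp k i j r), y)))); last by move=> j _.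
  by move=> j M M' hM h; apply: mono hM h.
exists K => -[r s].
have [k [i [j [hk hi hj H]]]] := sample_reaches (V r) K1 s.
have := hK k hk i hi j hj r; rewrite /smp.
case: H => [-> //|H] hc.
have loc x : Rmin (sample (V r) k i j) s <= x <= Rmax (sample (V r) k i j) s ->
    exists d, 0 < d /\ forall y, Rabs (y - x) < d ->
      (covered K (fun z => P ((r, y), z)) <-> covered K (fun z => P ((r, x), z))).
  move=> hx; have hm : match_at (fun q => P ((r, q.1), q.2)) x.
    apply: NNPP => hn; have [l [hl hel]] := he r x hn.
    by apply: (H l hl); rewrite /V hel.
  by have [d [hd Hd]] := match_covered _ _ hm; exists d; split=> // y hy; apply: Hd.
have := interval_connected (fun x => covered K (fun z => P ((r, x), z))) _ _ loc.
have : Rmin (sample (V r) k i j) s <= Rmax (sample (V r) k i j) s.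
  by apply: Rle_trans (Rmin_l _ _) (Rmax_l _ _).
by rewrite /Rmin /Rmax; case: Rle_dec => _ h /(_ h); tauto.
Qed.

(** The part of each fibre outside [[-1, 1]] is brought inside by inversion. *)
Lemma uniformly_finite_prod {T} {sT : space T} :
  uniformly_finite T -> uniformly_finite (T * R).
Proof.
move=> UF P hP hfin.
have [|||K1 h1] := uniformly_finite_prod_bounded
  (fun p => P p /\ -1 <= p.2 <= 1) UF; first by definability.
- by move=> t y [].
- by move=> t; have [l hl] := hfin t; exists l => y [/hl].
have [|||K2 h2] := uniformly_finite_prod_bounded
  (fun p => exists y, P (p.1, y) /\ (y < -1 \/ 1 < y) /\ p.2 = / y) UF; first by definability.
- move=> t z [y [_ [hy /= ->]]].
  have hi : / Rabs y <= 1.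
    rewrite -Rinv_1; apply: Rinv_le_contravar; first lra.
    by case: hy => ?; [rewrite Rabs_left|rewrite Rabs_pos_eq]; lra.
  by apply: Rabs_le_bounds; rewrite Rabs_inv.
- move=> t; have [l hl] := hfin t; exists (List.map Rinv l) => z [y [/hl hy [_ /= ->]]].
  exact: List.in_map.
exists (K1 + K2)%N => t; have [l1 [hl1 H1]] := h1 t; have [l2 [hl2 H2]] := h2 t.
exists (l1 ++ List.map Rinv l2)%list; split.
  by rewrite length_app length_map; lia.
move=> y hy; apply/List.in_or_app.
case: (classic (-1 <= y <= 1)) => hy1; first by left; apply: H1.
right; apply/List.in_map_iff; exists (/ y); split; first by rewrite Rinv_inv.
by apply: H2; exists y; split=> //; split=> //; lra.
Qed.

Lemma uniformly_finite_Rn n : uniformly_finite (Rn n).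
Proof.
elim: n => [|n IH] P hP hfin.
  have [l hl] := hfin (fun _ => 0); exists (length l) => t; exists l; split=> //.
  suff -> : t = (fun _ => 0) by [].
  by apply: functional_extensionality => -[].
have [||K hK] := uniformly_finite_prod IH (fun p => P (snoc p.1.1 p.1.2, p.2)).
- by definability.
- by move=> t; exact (hfin (snoc t.1 t.2)).
by exists K => t; have := hK (init t, t ord_max); rewrite /= snoc_init.
Qed.

Lemma dmap_dec {T} {sT : space T} : dmap (@dec T sT).
Proof. by apply: cmap_dmap; exists id => z i; rewrite decK. Qed.

Lemma uniform_finiteness {T} {sT : space T} : uniformly_finite T.
Proof.
move=> P hP hfin; have hd := @dmap_dec T sT.
have [||K hK] := uniformly_finite_Rn (dim T) (fun p => P (dec p.1, p.2)).
- by definability.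
- by move=> t; exact (hfin (dec t)).
by exists K => t; have := hK (enc t); rewrite /= encK.
Qed.

End UniformFiniteness.

(** * Decompositions with boundedly many parameters *)

Lemma below_neighbour_list {B} (v : B -> R) (V : list B) (s : R) :
  (forall b, List.In b V -> v b <> s) ->
  (forall b, List.In b V -> s < v b) \/
  exists b, [/\ List.In b V, v b < s & forall b', List.In b' V -> v b' <= v b \/ s < v b'].
Proof.
move=> h; case: V h => [|b0 V] h; first by left.
set l := b0 :: V in h *; pose f i := v (List.nth i l b0).
have inl i : (i < length l)%N -> List.In (List.nth i l b0) l by move=> hi; apply: List.nth_In; lia.
have idx b : List.In b l -> exists i, (i < length l)%N /\ f i = v b.
  by move=> /(List.In_nth l b b0) [i [hi hb]]; exists i; split; [lia|rewrite /f hb].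
have [|H|[i [hi hs H]]] := below_neighbour f (length l) s.
- by move=> i /inl; apply: h.
- by left=> b /idx [i [hi <-]]; apply: H.
- right; exists (List.nth i l b0); split=> //; first exact: inl.
  by move=> b' /idx [j [hj <-]]; apply: H.
Qed.

Lemma above_neighbour_list {B} (v : B -> R) (V : list B) (s : R) :
  (forall b, List.In b V -> v b <> s) ->
  (forall b, List.In b V -> v b < s) \/
  exists b, [/\ List.In b V, s < v b & forall b', List.In b' V -> v b <= v b' \/ v b' < s].
Proof.
move=> h; have [|H|[b [hb hs H]]] := below_neighbour_list (fun b => - v b) V (- s).
- by move=> b /h; lra.
- by left=> b /H; lra.
- by right; exists b; split=> //; [lra|move=> b' /H; lra].
Qed.

Section Decomposition.
Context {OM : omin}.

(* The point is that [Psi] does not depend on the number of elements of [A']. *)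
Definition decomposable X {sX : space X} : Prop :=
  forall (P : Type) (sP : space P) (A : P * X -> Prop), Def A ->
  exists (U : Type) (sU : space U) (Psi : U * X -> Prop), Def Psi /\
    forall A' : list P, exists W : list U, forall x0, exists w,
      [/\ List.In w W, Psi (w, x0) &
          forall a, List.In a A' -> forall x, Psi (w, x) -> (A (a, x) <-> A (a, x0))].

(* The tags [c.1.1] and [c.2.1] select the kind of each bound: 0 for no bound,
   1 for a strict bound by [ev], 2 for equality. *)
Definition in_cell {B X} (ev : B * X -> R) (c : (R * B) * (R * B)) (x : X) (y : R) : Prop :=
  (c.1.1 = 0 \/ (c.1.1 = 1 /\ ev (c.1.2, x) < y) \/ (c.1.1 = 2 /\ y = ev (c.1.2, x))) /\
  (c.2.1 = 0 \/ (c.2.1 = 1 /\ y < ev (c.2.2, x))).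

Definition cell_list {B} (b0 : B) (V : list B) : list ((R * B) * (R * B)) :=
  List.list_prod (List.list_prod (0 :: 1 :: 2 :: nil) (b0 :: V))
                 (List.list_prod (0 :: 1 :: nil) (b0 :: V)).

(** The cell is the value of [ev] at [y], or the open interval between the neighbouring values. [b0]
    only fills the slot of an absent bound. The last clause says that no value lies inside a cell
    that is not a single point. *)
Lemma cell_exists {B X} (ev : B * X -> R) (b0 : B) (V : list B) (x : X) (y : R) :
  exists c, [/\ List.In c (cell_list b0 V), in_cell ev c x y,
    (c.1.1 = 1 -> List.In c.1.2 V) /\ (c.2.1 = 1 -> List.In c.2.2 V) &
    c.1.1 = 2 \/ forall v, List.In v V -> ~ in_cell ev c x (ev (v, x))].
Proof.
have inlist t b t' b' : List.In t (0 :: 1 :: 2 :: nil) -> List.In b (b0 :: V) ->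
    List.In t' (0 :: 1 :: nil) -> List.In b' (b0 :: V) ->
    List.In ((t, b), (t', b')) (cell_list b0 V).
  by move=> *; apply: List.in_prod; apply: List.in_prod.
case: (classic (exists b, List.In b V /\ ev (b, x) = y)) => [[b [hb hy]]|hn].
  exists ((2, b), (0, b0)); split; [apply: inlist; simpl; tauto| | |by left].
    by split=> /=; [right; right|left].
  by split=> /=; lra.
have hne b : List.In b V -> ev (b, x) <> y by move=> hb hy; apply: hn; exists b.
case: (below_neighbour_list (fun b => ev (b, x)) V y hne) => [hl|[b [hb hby Hb]]];
  case: (above_neighbour_list (fun b => ev (b, x)) V y hne) => [hu|[b' [hb' hby' Hb']]].
- exists ((0, b0), (0, b0)); split; [apply: inlist; simpl; tauto|by split; left|by split=> /=; lra|].
  by right=> v hv _; have := hl v hv; have := hu v hv; lra.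
- exists ((0, b0), (1, b')); split; [apply: inlist; simpl; tauto|by split; [left|right]|
    by split=> //=; lra|].
  right=> v hv [_ /= [h|[_ hlt]]]; first lra.
  by have := hl v hv; case: (Hb' v hv); lra.
- exists ((1, b), (0, b0)); split; [apply: inlist; simpl; tauto|by split; [right; left|left]|
    by split=> //=; lra|].
  right=> v hv [/= [h|[[_ hlt]|[h _]]] _]; [lra| |lra].
  by have := hu v hv; case: (Hb v hv); lra.
exists ((1, b), (1, b')); split; [apply: inlist; simpl; tauto|by split; [right; left|right]|by split|].
right=> v hv [/= [h|[[_ hlt]|[h _]]] [h'|[_ hlt']]]; try lra.
by case: (Hb v hv); case: (Hb' v hv); lra.
Qed.

Lemma in_cell_convex {B X} (ev : B * X -> R) c (x : X) (y z y' : R) :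
  in_cell ev c x y -> in_cell ev c x y' -> y <= z <= y' -> in_cell ev c x z.
Proof.
move=> [[h1|[[h1 ?]|[h1 ?]]] [h2|[h2 ?]]] [[h1'|[[h1' ?]|[h1' ?]]] [h2'|[h2' ?]]] hz;
  (try by exfalso; lra); split;
  solve [by left | by right; left; split=> //; lra | by right; right; split=> //; lra
        | by right; split=> //; lra].
Qed.

(** The induction hypothesis is used for two families over the base: the order of two boundary
    values, and whether a cell meets [A] over [x]. Constant order keeps boundary values out of the
    cell over the whole base cell, so over each [x] the cell is inside [A] or outside it; the second
    family makes the answer independent of [x]. Two base parameters and two bounds are all that is
    stored. *)
Lemma decomposable_prod {X} {sX : space X} : decomposable X -> decomposable (X * R).
Proof.
move=> IH P sP A hA.
pose bd (p : (P * X) * R) := bdry (fun y => A (p.1.1, (p.1.2, y))) p.2.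
have hbd : Def bd by rewrite /bd /bdry; definability.
have [|K hK] := uniform_finiteness bd hbd.
  move=> [a x]; apply: (bdry_finite (fun y => A (a, (x, y)))).
  by definability.
have [e [de he]] := bounded_enum bd K hbd hK.
pose ev (q : (P * R) * X) := e ((q.1.1, q.2), q.1.2).
have dev : dmap ev by rewrite /ev; definability.
have hF1 : Def (fun q : ((P * R) * (P * R)) * X => ev (q.1.1, q.2) < ev (q.1.2, q.2)).
  by definability.
have hF2 : Def (fun q : (P * ((R * (P * R)) * (R * (P * R)))) * X =>
    exists y, in_cell ev q.1.2 q.2 y /\ A (q.1.1, (q.2, y))).
  by rewrite /in_cell; definability.
have [U1 [s1 [Psi1 [hPsi1 H1]]]] := IH _ _ _ hF1.
have [U2 [s2 [Psi2 [hPsi2 H2]]]] := IH _ _ _ hF2.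
pose C := ((R * (P * R)) * (R * (P * R)))%type.
exists ((U1 * U2) * C)%type, _, (fun q => Psi1 (q.1.1.1, q.2.1) /\ Psi2 (q.1.1.2, q.2.1) /\
  in_cell ev q.1.2 q.2.1 q.2.2).
split; first by rewrite /in_cell; definability.
move=> A'.
pose V := List.list_prod A' (List.map INR (List.seq 0 K)).
(* An arbitrary parameter, available even when [A'] is empty. *)
pose b0 : P * R := (@dec P sP (fun _ => 0), 0).
have [W1 hW1] := H1 (List.list_prod V V).
have [W2 hW2] := H2 (List.list_prod A' (cell_list b0 V)).
exists (List.list_prod (List.list_prod W1 W2) (cell_list b0 V)) => -[x0 y0].
have [w1 [hw1 hx1 const1]] := hW1 x0.
have [w2 [hw2 hx2 const2]] := hW2 x0.
have [c [hc hcell [hc1 hc2] hnov]] := cell_exists ev b0 V x0 y0.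
exists ((w1, w2), c); split=> //.
  by apply: List.in_prod => //; apply: List.in_prod.
have order b b' x : List.In b V -> List.In b' V -> Psi1 (w1, x) ->
    (ev (b, x) < ev (b', x) <-> ev (b, x0) < ev (b', x0)).
  by move=> hb hb'; apply: (const1 (b, b')); apply: List.in_prod.
have nov x : Psi1 (w1, x) -> c.1.1 = 2 \/ forall v, List.In v V -> ~ in_cell ev c x (ev (v, x)).
  move=> hx; case: hnov => [hnov|hnov]; [by left|].
  case: (Req_dec c.1.1 2) => h2; first by left.
  right=> v hv [hl hr]; apply: (hnov v hv); split.
    case: hl => [hl|[[hl hlt]|[hl _]]] //; [by left|right; left; split=> //].
    exact: (proj1 (order _ _ _ (hc1 hl) hv hx) hlt).
  case: hr => [hr|[hr hlt]]; [by left|right; split=> //].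
  exact: (proj1 (order _ _ _ hv (hc2 hr) hx) hlt).
have constA a x : List.In a A' -> Psi1 (w1, x) -> forall y y', in_cell ev c x y ->
    in_cell ev c x y' -> A (a, (x, y)) -> A (a, (x, y')).
  move=> ha hx y y' hy hy'.
  case: (nov x hx) => [h2|hno].
    case: hy hy' => [[?|[[? ?]|[_ ->]]] _] [[?|[[? ?]|[_ ->]]] _] //; lra.
  have free z : bd ((a, x), z) -> ~ in_cell ev c x z.
    move=> /he [i [hi <-]]; apply: (hno (a, INR i)).
    by apply: List.in_prod => //; apply: List.in_map; apply/List.in_seq; lia.
  case: (Rle_dec y y') => hyy.
    apply: (proj1 (bdry_free_const (fun y => A (a, (x, y))) y y' _ hyy)) => z hz hb.
    by apply: (free z hb); apply: in_cell_convex hy hy' hz.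
  have hyy' : y' <= y by lra.
  apply: (proj2 (bdry_free_const (fun y => A (a, (x, y))) y' y _ hyy')) => z hz hb.
  by apply: (free z hb); apply: in_cell_convex hy' hy hz.
move=> a ha [x y] [/= hx [hx' hy]].
have := const2 (a, c) (List.in_prod _ _ _ _ ha hc) x hx' => /= E.
split=> h.
  have [|y' [hy' hA']] := proj1 E; first by exists y.
  by apply: (constA a x0 ha hx1 _ _ hy' hcell).
have [|y' [hy' hA']] := proj2 E; first by exists y0.
by apply: (constA a x ha hx _ _ hy' hy).
Qed.

Lemma decomposable_Rn n : decomposable (Rn n).
Proof.
elim: n => [|n IH] P sP A hA.
  exists (Rn 0), _, (fun _ => True); split; first exact: Def_const.
  move=> A'; exists ((fun _ => 0) :: nil) => x0; exists (fun _ => 0); split=> //.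
    by left.
  move=> a _ x _; suff -> : x = x0 by [].
  by apply: functional_extensionality => -[].
have hA' : Def (fun p : P * (Rn n * R) => A (p.1, snoc p.2.1 p.2.2)) by definability.
have [U [sU [Psi [hPsi H]]]] := decomposable_prod IH P sP _ hA'.
exists U, sU, (fun p => Psi (p.1, (init p.2, p.2 ord_max))); split; first by definability.
move=> A'; have [W hW] := H A'; exists W => x0.
have [w [hw hx hc]] := hW (init x0, x0 ord_max); exists w; split=> // a ha x hx'.
by have := hc a ha _ hx'; rewrite /= !snoc_init.
Qed.

End Decomposition.

(** * Uniform polynomial lower bounds *)

Lemma scale_range (t r d : R) k : 0 < r <= 1 -> 0 < t < d -> 0 < t * r ^ k < d.
Proof.
move=> hr ht; have h0 : 0 < r ^ k by apply: pow_lt; lra.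
have h1 : r ^ k <= 1 by rewrite -(pow1 k); apply: pow_incr; lra.
split; first by apply: Rmult_lt_0_compat; lra.
by apply: Rle_lt_trans (proj2 ht); rewrite -{2}(Rmult_1_r t); apply: Rmult_le_compat_l; lra.
Qed.

Lemma iterate_le (phi : R -> R) (d r X : R) : 0 < r <= 1 -> 0 <= X ->
  (forall t, 0 < t < d -> phi (t * r) * X <= phi t) ->
  forall k t, 0 < t < d -> phi (t * r ^ k) * X ^ k <= phi t.
Proof.
move=> hr hX h; elim=> [|k IH] t ht /=; first by rewrite !Rmult_1_r; lra.
apply: Rle_trans (IH t ht); have := h _ (scale_range t r d k hr ht).
have -> : t * (r * r ^ k) = t * r ^ k * r by ring.
move=> h'; rewrite -Rmult_assoc; apply: Rmult_le_compat_r => //; exact: pow_le.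
Qed.

Lemma iterate_ge (phi : R -> R) (d r X : R) : 0 < r <= 1 -> 0 <= X ->
  (forall t, 0 < t < d -> phi t <= phi (t * r) * X) ->
  forall k t, 0 < t < d -> phi t <= phi (t * r ^ k) * X ^ k.
Proof.
move=> hr hX h; elim=> [|k IH] t ht /=; first by rewrite !Rmult_1_r; lra.
apply: Rle_trans (IH t ht) _; have := h _ (scale_range t r d k hr ht).
have -> : t * (r * r ^ k) = t * r ^ k * r by ring.
move=> h'; rewrite -Rmult_assoc; apply: Rmult_le_compat_r => //; exact: pow_le.
Qed.

Section PolynomiallyBounded.
Context {OM : omin} (Hpb : poly_bounded dset).

Lemma poly_upper_bound (h : R -> R) : dmap h ->
  exists (N : nat) (c : R), forall x, c < x -> Rabs (h x) < x ^ N.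
Proof.
move=> dh; apply: Hpb.
have hd : Def (fun z : Rn 2 => z ord_max = h (init z ord0)) by definability.
exact: hd.
Qed.

(** Decay at 0 becomes growth at infinity for the reciprocal after [x = / t]. *)
Lemma poly_lower_bound (phi : R -> R) : dmap phi -> (forall t, 0 < t -> 0 < phi t) ->
  exists (N : nat) (d : R), 0 < d /\ forall t, 0 < t < d -> t ^ N < phi t.
Proof.
move=> dphi hpos; have dh : dmap (fun x => / phi (/ x)) by definability.
have [N [c hc]] := poly_upper_bound _ dh.
exists N, (/ Rmax c 1).
have hm := Rmax_r c 1; have hm' := Rmax_l c 1.
split; first by apply: Rinv_0_lt_compat; lra.
move=> t [t0 ht].
have hx : Rmax c 1 < / t.
  by rewrite -(Rinv_inv (Rmax c 1)); apply: Rinv_0_lt_contravar.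
have := hc (/ t) _; rewrite Rinv_inv => /(_ ltac:(lra)).
have p0 := hpos t t0; have tN : 0 < t ^ N by apply: pow_lt.
rewrite Rabs_pos_eq; last by apply/Rlt_le/Rinv_0_lt_compat.
rewrite pow_inv => hlt; apply: Rnot_le_lt => hle.
by have := Rinv_le_contravar _ _ p0 hle; lra.
Qed.

Lemma germ_zero (P : R -> Prop) : Def P ->
  (exists d, 0 < d /\ forall t, 0 < t < d -> P t) \/
  (exists d, 0 < d /\ forall t, 0 < t < d -> ~ P t).
Proof.
move=> hP; have [d [hd]] := germ_right P 0 hP; rewrite Rplus_0_l.
by case=> h; [left|right]; exists d.
Qed.

(* If no exponent worked, then for [X >= 2] some [phi (u, _)] would shrink by a
   factor [X] whenever [t] is halved; choosing for each [X] a bound [c] of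
   [phi (u, t) / phi (u, t / X)] gives a definable function of [X] which is at
   least [2 ^ (k * k)] at [X = 2 ^ k], hence is not polynomially bounded. *)
Lemma uniform_poly_lower_bound {U} {sU : space U} (phi : U * R -> R) (good : U -> Prop) :
  dmap phi -> Def good -> (forall u t, good u -> 0 < t -> 0 < phi (u, t)) ->
  exists N : nat, forall u, good u ->
    exists d, 0 < d /\ forall t, 0 < t < d -> t ^ N < phi (u, t).
Proof.
move=> dphi hgood hpos; apply: NNPP => hno.
have hN N : exists u, good u /\ exists d, 0 < d /\ forall t, 0 < t < d -> phi (u, t) <= t ^ N.
  apply: NNPP => hn; apply: hno; exists N => u hu.
  have hd : Def (fun t => t ^ N < phi (u, t)) by definability.
  case: (germ_zero _ hd) => // -[d [hd0 h]]; case: hn; exists u; split=> //.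
  by exists d; split=> // t /h /Rnot_lt_le.
pose C (p : R * R) := 0 < p.2 /\ exists u, good u /\
  (exists d, 0 < d /\ forall t, 0 < t < d -> phi (u, t * / 2) * p.1 <= phi (u, t)) /\
  (exists d, 0 < d /\ forall t, 0 < t < d -> phi (u, t) <= p.2 * phi (u, t * / p.1)).
have hC : Def C by rewrite /C; definability.
have exC X : 2 <= X -> exists c, C (X, c).
  move=> hX; have hX0 : 0 < / X by apply: Rinv_0_lt_compat; lra.
  have hX1 : / X <= / 2 by apply: Rinv_le_contravar; lra.
  (* This means [X < 2 ^ N]: a function below [t ^ N] loses more than a factor [X] per halving in
     the long run, so it cannot satisfy the reverse inequality near 0. *)
  have [N hNX] := geometric_small X (/ 2) 1 ltac:(lra) ltac:(lra).
  have [u [hu [d1 [hd1 h1]]]] := hN N.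
  have dphiu : dmap (fun t => phi (u, t)) by definability.
  have [N' [d2 [hd2 h2]]] := poly_lower_bound _ dphiu (fun t => hpos u t hu).
  (* One power of [X] more than the lower bound [t ^ N'] permits: losing a factor [c] at each
     division by [X] would eventually violate that bound. *)
  pose c := X ^ N'.+1; have hc : 0 < c by apply: pow_lt; lra.
  exists c; split=> //; exists u; split=> //; split.
    have hd : Def (fun t => phi (u, t * / 2) * X <= phi (u, t)) by definability.
    case: (germ_zero _ hd) => // -[d [hd0 h]]; exfalso.
    pose t0 := Rmin d1 d / 2.
    have t0p : 0 < Rmin d1 d by apply: Rmin_glb_lt.
    have ht0 : 0 < t0 < d /\ 0 < t0 < d1.
      by have := Rmin_l d1 d; have := Rmin_r d1 d; rewrite /t0; lra.
    have {}h t : 0 < t < d -> phi (u, t) <= phi (u, t * / 2) * X.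
      by move=> /h; lra.
    have it := iterate_ge (fun t => phi (u, t)) d (/ 2) X ltac:(lra) ltac:(lra) h.
    have hr : 0 <= X * (/ 2) ^ N < 1.
      by split=> //; apply: Rmult_le_pos; [lra|apply: pow_le; lra].
    have [k hk] := geometric_small (t0 ^ N) _ _ hr (hpos u t0 hu (proj1 (proj1 ht0))).
    have := it k t0 (proj1 ht0); have := h1 _ (scale_range t0 (/ 2) d1 k ltac:(lra) (proj2 ht0)).
    have Xk : 0 <= X ^ k by apply: pow_le; lra.
    move=> hle /(Rle_trans _ _ _) /(_ (Rmult_le_compat_r _ _ _ Xk hle)).
    have -> : (t0 * (/ 2) ^ k) ^ N * X ^ k = t0 ^ N * (X * (/ 2) ^ N) ^ k.
      rewrite !Rpow_mult_distr -!pow_mult Nat.mul_comm; ring.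
    lra.
  have hd : Def (fun t => phi (u, t) <= c * phi (u, t * / X)) by definability.
  case: (germ_zero _ hd) => // -[d [hd0 h]]; exfalso.
  pose t0 := Rmin d2 d / 2.
  have t0p : 0 < Rmin d2 d by apply: Rmin_glb_lt.
  have ht0 : 0 < t0 < d /\ 0 < t0 < d2.
    by have := Rmin_l d2 d; have := Rmin_r d2 d; rewrite /t0; lra.
  have {}h t : 0 < t < d -> phi (u, t * / X) * c <= phi (u, t).
    by move=> /h; lra.
  have it := iterate_le (fun t => phi (u, t)) d (/ X) c ltac:(lra) ltac:(lra) h.
  have hr : 0 <= / X < 1 by lra.
  have tN : 0 < t0 ^ N' by apply: pow_lt; lra.
  have [k hk] := geometric_small (phi (u, t0)) _ _ hr tN.
  have := it k t0 (proj1 ht0); have := h2 _ (scale_range t0 (/ X) d2 k ltac:(lra) (proj2 ht0)).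
  have ck : 0 < c ^ k by apply: pow_lt.
  move=> hle /(Rlt_le_trans _ _ _ (Rmult_lt_compat_r _ _ _ ck hle)).
  have Xk : 0 < X ^ k by apply: pow_lt; lra.
  have -> : (t0 * (/ X) ^ k) ^ N' * c ^ k = t0 ^ N' * X ^ k.
    rewrite Rpow_mult_distr /c -!pow_mult !pow_inv.
    have -> : Nat.mul N'.+1 k = Nat.add (Nat.mul k N') k by lia.
    rewrite pow_add; field; apply: pow_nonzero; lra.
  move=> hlt; have := Rmult_lt_compat_r _ _ _ Xk hk.
  have -> : phi (u, t0) * (/ X) ^ k * X ^ k = phi (u, t0).
    by rewrite pow_inv; field; lra.
  lra.
have [H [dH HH]] := def_inf C hC.
(* The infimum may not be an admissible constant, but some admissible [c] lies below [H x + 1]. *)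
have dh : dmap (fun x => H x + 1) by definability.
have [N [c0 hc0]] := poly_upper_bound _ dh.
have [k0 hk0] := geometric_small (Rabs c0 + 1) (/ 2) 1 ltac:(lra) ltac:(lra).
(* [k0] brings [X] beyond [c0], [N] gives [X ^ N <= X ^ k], and the final 1 gives [2 <= X]. Since
   [k] halvings amount to one division by [X], the two conditions in [C] combine to [X ^ k <= c]. *)
pose k := (k0 + N + 1)%N; pose X := 2 ^ k.
have hX2 : 2 <= X.
  have -> : X = 2 * 2 ^ (k0 + N) by rewrite /X /k addn1.
  have := pow_R1_Rle 2 (k0 + N) ltac:(lra); lra.
have hXc : c0 < X.
  have h2 : 0 < 2 ^ k0 by apply: pow_lt; lra.
  have : Rabs c0 + 1 < 2 ^ k0.
    have := Rmult_lt_compat_r _ _ _ h2 hk0; rewrite pow_inv.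
    have -> : (Rabs c0 + 1) * / 2 ^ k0 * 2 ^ k0 = Rabs c0 + 1 by field; lra.
    lra.
  have : 2 ^ k0 <= X by apply: Rle_pow; [lra|rewrite /k; lia].
  by have := Rle_abs c0; lra.
have [|Hl Hc] := HH X (exC X hX2); first by exists 0 => y [/=]; lra.
have [c [[/= hc [u [hu [[d1 [hd1 h1]] [d2 [hd2 h2]]]]]] hcH]] := Hc 1 Rlt_0_1.
have := hc0 X hXc; move/(Rle_lt_trans _ _ _ (Rle_abs _)) => hlt.
pose t0 := Rmin d1 d2 / 2.
have t0p : 0 < Rmin d1 d2 by apply: Rmin_glb_lt.
have ht0 : 0 < t0 < d1 /\ 0 < t0 < d2.
  by have := Rmin_l d1 d2; have := Rmin_r d1 d2; rewrite /t0; lra.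
have := iterate_le (fun t => phi (u, t)) d1 (/ 2) X ltac:(lra) ltac:(lra) h1 k t0 (proj1 ht0).
have := h2 t0 (proj2 ht0).
have hp : 0 < phi (u, t0 * / X).
  by apply: hpos => //; apply: Rmult_lt_0_compat; [lra|apply: Rinv_0_lt_compat; lra].
have -> : (/ 2) ^ k = / X by rewrite pow_inv.
move=> hA hB; have hXk : X ^ k <= c.
  apply: (Rmult_le_reg_l (phi (u, t0 * / X))) => //.
  by rewrite [_ * c]Rmult_comm; lra.
have : X ^ N <= X ^ k by apply: Rle_pow; [lra|rewrite /k; lia].
lra.
Qed.

End PolynomiallyBounded.

(** * The Lojasiewicz inequality *)

Lemma snoc_near n (z : Rn n.+1) (x : Rn n) (y e : R) :
  (forall j, Rabs (init z j - x j) < e) -> Rabs (z ord_max - y) < e ->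
  forall i, Rabs (z i - snoc x y i) < e.
Proof.
move=> h1 h2 i; rewrite -{1}(snoc_init _ z) /snoc.
by case: unliftP => [j _|_].
Qed.

(** The tube lemma: compactness in the first coordinates thickens each slice, and compactness of the
    interval finishes in the last one. *)
Lemma box_compact n (Q : (Rn n -> Prop) -> Prop) (x0 : Rn n) (r : R) :
  (forall X Y : Rn n -> Prop, (forall x, X x -> Y x) -> Q Y -> Q X) ->
  (forall X Y, Q X -> Q Y -> Q (fun x => X x \/ Y x)) ->
  (forall x, exists e, 0 < e /\ Q (fun y => forall i, Rabs (y i - x i) < e)) ->
  Q (fun x => forall i, Rabs (x i - x0 i) <= r).
Proof.
elim: n Q x0 => [|n IH] Q x0 mono union loc.
  have [e [he h]] := loc x0.
  by apply: (mono _ _ _ h) => x _ [].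
have slice y : exists e, 0 < e /\ Q (fun z =>
    (forall j, Rabs (init z j - init x0 j) <= r) /\ Rabs (z ord_max - y) < e).
  apply: (IH (fun X => exists e, 0 < e /\ Q (fun z =>
    X (init z) /\ Rabs (z ord_max - y) < e)) (init x0)).
  - move=> X Y hXY [e [he h]]; exists e; split=> //.
    by apply: (mono _ _ _ h) => z [hz hz']; split=> //; exact: hXY.
  - move=> X Y [e [he h]] [e' [he' h']]; exists (Rmin e e'); split.
      exact: Rmin_glb_lt.
    have [m1 m2] := (Rmin_l e e', Rmin_r e e').
    apply: (mono _ _ _ (union _ _ h h')) => z [[hz|hz] hz']; [left|right];
      by split=> //; lra.
  - move=> x; have [e [he h]] := loc (snoc x y); exists e; split=> //.
    exists e; split=> //; apply: (mono _ _ _ h) => z [h1 h2].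
    exact: snoc_near.
case: (Rle_dec 0 r) => hr; last first.
  have [e [he h]] := loc x0; apply: (mono _ _ _ h) => z hz i.
  by have := hz i; have := Rabs_pos (z i - x0 i); lra.
have h := interval_compact (fun Y => Q (fun z =>
  (forall j, Rabs (init z j - init x0 j) <= r) /\ Y (z ord_max)))
  (x0 ord_max - r) (x0 ord_max + r).
apply: (mono _ (fun z => (forall j, Rabs (init z j - init x0 j) <= r) /\
  x0 ord_max - r <= z ord_max <= x0 ord_max + r)).
  move=> z hz; split=> [j|]; first exact: hz.
  by have := Rabs_le_bounds _ _ (hz ord_max); lra.
apply: h => [X Y hXY h|X Y hX hY|y _|].
- by apply: (mono _ _ _ h) => z [h1 h2]; split=> //; exact: hXY.
- by apply: (mono _ _ _ (union _ _ hX hY)) => z [h1 [h2|h2]]; [left|right].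
- exact: slice.
- lra.
Qed.

Definition continuous_within {n} (S : Rn n -> Prop) (f : Rn n -> R) (x : Rn n) : Prop :=
  forall eps, 0 < eps -> exists delta, 0 < delta /\
    forall y, S y -> (forall i, Rabs (y i - x i) < delta) -> Rabs (f y - f x) < eps.

Lemma continuous_within_near {n} (S : Rn n -> Prop) (f : Rn n -> R) (x : Rn n) (P : R -> Prop) :
  continuous_within S f x ->
  (exists e, 0 < e /\ forall v, Rabs (v - f x) < e -> P v) ->
  exists d, 0 < d /\ forall y, S y -> (forall i, Rabs (y i - x i) < d) -> P (f y).
Proof.
move=> hf [e [he hP]]; have [d [hd h]] := hf e he; exists d; split=> // y hy hn.
by apply: hP; exact: h.
Qed.

Lemma continuous_within_comp {n} (S : Rn n -> Prop) (f : Rn n -> R) (x : Rn n) (u : R -> R) :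
  continuity_pt u (f x) -> continuous_within S f x ->
  continuous_within S (fun y => u (f y)) x.
Proof.
move=> hu hf e he; have [d [hd h]] := hu e he.
apply: (continuous_within_near _ _ _ (fun v => Rabs (u v - u (f x)) < e) hf).
exists d; split=> // v hv; case: (Req_dec v (f x)) => [->|hne].
  by rewrite Rminus_diag Rabs_R0.
by apply: h; split=> //; split=> //; exact: not_eq_sym.
Qed.

Lemma continuous_within_mul {n} (S : Rn n -> Prop) (f g : Rn n -> R) (x : Rn n) :
  continuous_within S f x -> continuous_within S g x ->
  continuous_within S (fun y => f y * g y) x.
Proof.
move=> hf hg e he.
pose M := Rabs (f x) + Rabs (g x) + 1.
have [pf pg] := (Rabs_pos (f x), Rabs_pos (g x)).
have M0 : 0 < M by rewrite /M; lra.
pose e1 := Rmin 1 (e / (2 * M)).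
have hM : 0 < e / (2 * M) by apply: Rdiv_lt_0_compat; lra.
have he1 : 0 < e1 by apply: Rmin_glb_lt; lra.
have [m1 m2] := (Rmin_l 1 (e / (2 * M)), Rmin_r 1 (e / (2 * M))); rewrite -/e1 in m1 m2.
have [d1 [hd1 h1]] := hf e1 he1; have [d2 [hd2 h2]] := hg e1 he1.
exists (Rmin d1 d2); split; first exact: Rmin_glb_lt.
have [k1 k2] := (Rmin_l d1 d2, Rmin_r d1 d2).
move=> y hy hn.
have hA : Rabs (f y - f x) < e1 by apply: h1 => // i; have := hn i; lra.
have hB : Rabs (g y - g x) < e1 by apply: h2 => // i; have := hn i; lra.
have -> : f y * g y - f x * g x =
  (f y - f x) * (g y - g x) + (f x * (g y - g x) + g x * (f y - f x)) by ring.
have t1 := Rabs_triang ((f y - f x) * (g y - g x)) (f x * (g y - g x) + g x * (f y - f x)).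
have t2 := Rabs_triang (f x * (g y - g x)) (g x * (f y - f x)).
rewrite !Rabs_mult in t1 t2.
have [qf qg] := (Rabs_pos (f y - f x), Rabs_pos (g y - g x)).
have b1 : Rabs (f y - f x) * Rabs (g y - g x) <= 1 * e1 by apply: Rmult_le_compat; lra.
have b2 : Rabs (f x) * Rabs (g y - g x) <= Rabs (f x) * e1 by apply: Rmult_le_compat_l; lra.
have b3 : Rabs (g x) * Rabs (f y - f x) <= Rabs (g x) * e1 by apply: Rmult_le_compat_l; lra.
have b4 : M * e1 <= M * (e / (2 * M)) by apply: Rmult_le_compat_l; lra.
have E : M * (e / (2 * M)) = e / 2 by field; lra.
have E' : M * e1 = Rabs (f x) * e1 + Rabs (g x) * e1 + e1 by rewrite /M; ring.
lra.
Qed.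

Lemma bool_gen_const {n} (gens : list (Rn n -> Prop)) (X : Rn n -> Prop) (x x0 : Rn n) :
  bool_gen gens X -> (forall Y, List.In Y gens -> (Y x <-> Y x0)) -> (X x <-> X x0).
Proof.
move=> hX hY; elim: hX => [Y hg| |Y _ IH|Y Z _ IH1 _ IH2|Y Z _ IH h].
- exact: hY.
- by split.
- by rewrite IH.
- by rewrite IH1 IH2.
- by rewrite -!h.
Qed.

(** This is how the cells control Boolean combinations of any length. *)
Lemma family_set_const {m n} (calA : Rn (m + n)%N -> Prop) A' (X : Rn n -> Prop) (x x0 : Rn n) :
  family_set calA A' X ->
  (forall a, List.In a A' -> (calA (concat a x) <-> calA (concat a x0))) -> (X x <-> X x0).
Proof.
move=> hX h; apply: bool_gen_const hX _ => Y /List.in_map_iff [a [<- ha]].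
exact: h.
Qed.

Section Lojasiewicz.
Context {OM : omin}.

Lemma family_set_Def {m n} (calA : Rn (m + n)%N -> Prop) A' (X : Rn n -> Prop) :
  Def calA -> family_set calA A' X -> Def X.
Proof.
move=> hA; elim=> [Y /List.in_map_iff [a [<- ha]]| |Y _ IH|Y Z _ IH1 _ IH2|Y Z _ IH h].
- by rewrite /fiber; definability.
- exact: Def_const.
- exact: Def_not.
- exact: Def_or.
- exact: Def_ext IH h.
Qed.

Lemma definable_fun_dmap {n} (f : Rn n -> R) : definable_fun dset f -> dmap f.
Proof.
move=> hf; have hg : Def (graph f) by exact: hf.
apply: (dmap_graph _ (fun x y => graph f (snoc x y))).
  by move=> x y; rewrite /graph snoc_last init_snoc; split=> ->.
by definability.
Qed.

(** Every point has a neighbourhood that avoids [S], or where [|g| < t] on [S], or where [|f|] keeps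
    half of its nonzero value on [S]. The first case rests on [S] being closed. *)
Lemma compact_lower_bound {n} (S : Rn n -> Prop) (f g : Rn n -> R) (x0 : Rn n) (t : R) :
  closed_in_Rn S -> continuous_on_set S f -> continuous_on_set S g ->
  (forall x, S x -> f x = 0 -> g x = 0) -> 0 < t ->
  exists s, 0 < s /\ forall x, (forall i, Rabs (x i - x0 i) <= 1) -> S x ->
    t <= Rabs (g x) -> s <= Rabs (f x).
Proof.
move=> hS hf hg hfg ht.
apply: (box_compact n (fun X => exists s, 0 < s /\ forall x, X x -> S x ->
    t <= Rabs (g x) -> s <= Rabs (f x))).
- by move=> X Y hXY [s [hs h]]; exists s; split=> // x /hXY; exact: h.
- move=> X Y [s [hs h]] [s' [hs' h']]; exists (Rmin s s'); split.
    exact: Rmin_glb_lt.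
  have [m1 m2] := (Rmin_l s s', Rmin_r s s').
  by move=> x [hx|hx] hSx hgx; [have := h x hx hSx hgx|have := h' x hx hSx hgx]; lra.
move=> x; case: (classic (S x)) => hx; last first.
  have [e [he h]] := hS x hx; exists e; split=> //; exists 1; split; first lra.
  by move=> y hy hSy; case: (h y hy).
case: (Rlt_dec (Rabs (g x)) t) => hgx.
  have [|d [hd h]] := continuous_within_near S g x (fun v => Rabs v < t) (hg x hx).
    exists (t - Rabs (g x)); split; first lra.
    move=> v hv; have := Rabs_triang (v - g x) (g x).
    have -> : v - g x + g x = v by ring.
    lra.
  exists d; split=> //; exists 1; split; first lra.
  by move=> y hy hSy; have := h y hSy hy; lra.
have fx : 0 < Rabs (f x).
  apply: Rabs_pos_lt => /(hfg x hx) g0.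
  by rewrite g0 Rabs_R0 in hgx; lra.
have [|d [hd h]] := continuous_within_near S f x (fun v => Rabs (f x) / 2 <= Rabs v) (hf x hx).
  exists (Rabs (f x) / 2); split; first lra.
  move=> v hv; have := Rabs_triang v (f x - v).
  have -> : v + (f x - v) = f x by ring.
  by rewrite [Rabs (f x - v)]Rabs_minus_sym; lra.
exists d; split=> //; exists (Rabs (f x) / 2); split; first lra.
by move=> y hy hSy _; exact: h.
Qed.

End Lojasiewicz.

Theorem theorem5p14
  (D : forall n : nat, (Rn n -> Prop) -> Prop)
  (HD : ominimal_expansion D) (Hpb : poly_bounded D)
  (n m p : nat)
  (A : Rn m -> Prop) (calA : Rn (m + n)%N -> Prop) (HA : definable_family D A calA)
  (B : Rn p -> Prop) (calB : Rn (p + n.+1)%N -> Prop) (HB : definable_family D B calB) :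
  exists N : nat, (0 < N)%N /\
    forall (A' : list (Rn m)) (B' B'' : list (Rn p))
           (S : Rn n -> Prop) (F G : Rn n.+1 -> Prop) (f g : Rn n -> R),
      (forall a, List.In a A' -> A a) ->
      (forall b, List.In b B' -> B b) ->
      (forall b, List.In b B'' -> B b) ->
      closed_in_Rn S -> family_set calA A' S ->
      family_set calB B' F -> family_set calB B'' G ->
      definable_fun D f -> definable_fun D g ->
      (forall z, F z <-> graph f z) -> (forall z, G z <-> graph g z) ->
      continuous_on_set S f -> continuous_on_set S g ->
      (forall x, S x -> f x = 0 -> g x = 0) ->
      exists h : Rn n -> R,
        definable_fun_on D S h /\ continuous_on_set S h /\
        forall x, S x -> g x ^ N = h x * f x.
Proof.
have [OM E] : exists OM : omin, D = dset by exists (Omin D HD).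
move: Hpb HA HB; rewrite {}E => {D HD} Hpb HA HB.
have hcA : Def calA by exact: (proj1 (proj2 HA)).
have hcB : Def calB by exact: (proj1 (proj2 HB)).
have hA : Def (fun q : Rn m * Rn n => calA (concat q.1 q.2)) by definability.
have hB : Def (fun q : Rn p * Rn n.+1 => calB (concat q.1 q.2)) by definability.
have [UA [sA [PsiA [hPsiA decA]]]] := decomposable_Rn n _ _ _ hA.
have [UB [sB [PsiB [hPsiB decB]]]] := decomposable_Rn n.+1 _ _ _ hB.
(* Here [y] and [z] stand for [f x] and [g x], known only through their cells. The value 1 keeps the
   set nonempty, and the unit box around the base point provides compactness. *)
pose values (q : ((((UA * UB) * UB) * Rn n) * R) * R) := q.2 = 1 \/
  exists (x : Rn n) (y z : R), PsiA (q.1.1.1.1.1, x) /\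
    PsiB (q.1.1.1.1.2, snoc x y) /\ PsiB (q.1.1.1.2, snoc x z) /\
    (forall i, Rabs (x i - q.1.1.2 i) <= 1) /\ q.1.2 <= Rabs z /\ q.2 = Rabs y.
have hval : Def values by rewrite /values; definability.
have [phi [dphi Hphi]] := def_inf values hval.
have {}Hphi q : (forall s, values (q, s) -> phi q <= s) /\
    (forall e, 0 < e -> exists s, values (q, s) /\ s < phi q + e).
  apply: Hphi; first by exists 1; left.
  exists 0 => s [/= ->|[x [y [z [_ [_ [_ [_ [_ /= ->]]]]]]]]]; first lra.
  exact: Rabs_pos.
(* Arbitrary cells need not give a positive infimum. Selecting those that do is a definable
   condition free of [S], [f] and [g], so [N] is fixed before they are. *)
have hgood : Def (fun u : ((UA * UB) * UB) * Rn n => forall t, 0 < t -> 0 < phi (u, t)).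
  by definability.
have [N hN] := uniform_poly_lower_bound Hpb phi _ dphi hgood (fun u t h => h t).
exists N.+1; split=> // A' B' B'' S F G f g _ _ _ hS hSA hFB hGB deff defg hF hG cf cg hfg.
have df : dmap f by exact: definable_fun_dmap.
have dg : dmap g by exact: definable_fun_dmap.
have dS : Def S by exact: family_set_Def hcA hSA.
(* At zeros of [f] in [S] this is 0 whatever [/ 0] is, because [g] vanishes there. *)
exists (fun x => g x ^ N.+1 * / f x); split; [|split].
- have hd : Def (fun z : Rn n.+1 => S (init z) /\ z ord_max = g (init z) ^ N.+1 * / f (init z)).
    by definability.
  exact: hd.
- move=> x0 hx0; case: (Req_dec (f x0) 0) => fx0; last first.
    apply: continuous_within_mul.
      apply: (continuous_within_comp S g x0 (fun v => v ^ N.+1)); last exact: cg.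
      exact/derivable_continuous_pt/derivable_pt_pow.
    apply: (continuous_within_comp S f x0 Rinv); last exact: cf.
    apply: (continuity_pt_inv id) => //; exact/derivable_continuous_pt/derivable_pt_id.
  have gx0 := hfg x0 hx0 fx0.
  have [WA hWA] := decA A'; have [WF hWF] := decB B'; have [WG hWG] := decB B''.
  pose useful (w : (UA * UB) * UB) := [/\ forall x, PsiA (w.1.1, x) -> S x,
    forall z, PsiB (w.1.2, z) -> F z & forall z, PsiB (w.2, z) -> G z].
  have useful_good w : useful w -> forall t, 0 < t -> 0 < phi ((w, x0), t).
    move=> [h1 h2 h3] t ht.
    have [s [hs Hs]] := compact_lower_bound S f g x0 t hS cf cg hfg ht.
    apply: Rnot_le_lt => hle; have [_ H] := Hphi ((w, x0), t).
    have [m1 m2] := (Rmin_l 1 s, Rmin_r 1 s).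
    have hm : 0 < Rmin 1 s by apply: Rmin_glb_lt; lra.
    have [v [[/= ->|[x [y [z [/= k1 [k2 [k3 [k4 [k5 ->]]]]]]]]] hv]] := H _ hm; first lra.
    have /hF := h2 _ k2; rewrite /graph snoc_last init_snoc => Ey.
    have /hG := h3 _ k3; rewrite /graph snoc_last init_snoc => Ez.
    have := Hs x k4 (h1 x k1); rewrite -Ey -Ez => /(_ k5); lra.
  (* Only here does the number of cells matter: it affects the radius [d0], not the exponent. *)
  have [d0 [hd0 H0]] : exists d, 0 < d /\ forall d', 0 < d' <= d ->
      forall w, List.In w (List.list_prod (List.list_prod WA WF) WG) ->
      useful w -> forall t, 0 < t < d' -> t ^ N < phi ((w, x0), t).
    apply: (list_min_pos _ (fun w d' => useful w -> forall t, 0 < t < d' -> t ^ N < phi ((w, x0), t))).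
    move=> w _; case: (classic (useful w)) => hw; last first.
      by exists 1; split; [lra|move=> e _ /hw].
    have [d [hd H]] := hN (w, x0) (useful_good w hw).
    by exists d; split=> // e he _ t ht; apply: H; lra.
  (* Below [d0], [|g x|] may be used as [t] in the lower bound; below [e], it bounds the quotient as
     required. *)
  move=> e he; pose e1 := Rmin e d0.
  have he1 : 0 < e1 by apply: Rmin_glb_lt.
  have [m1 m2] := (Rmin_l e d0, Rmin_r e d0); rewrite -/e1 in m1 m2.
  have [d [hd H]] := cg x0 hx0 e1 he1.
  exists (Rmin d 1); split; first by apply: Rmin_glb_lt; lra.
  have [k1 k2] := (Rmin_l d 1, Rmin_r d 1).
  move=> x hx hn.
  have -> : g x0 ^ N.+1 * / f x0 = 0 by rewrite gx0 /=; ring.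
  rewrite Rminus_0_r.
  case: (Req_dec (g x) 0) => gx.
    by rewrite gx /= !Rmult_0_l Rabs_R0.
  have hgx : Rabs (g x) < e1.
    by have := H x hx; rewrite gx0 Rminus_0_r; apply=> i; have := hn i; lra.
  have [wA [hwA pA cA]] := hWA x.
  have [wF [hwF pF cF]] := hWF (snoc x (f x)).
  have [wG [hwG pG cG]] := hWG (snoc x (g x)).
  have hu : useful ((wA, wF), wG).
    split=> /= y hy.
    - by apply/(family_set_const _ _ _ _ x hSA) => // a ha; exact: cA.
    - apply/(family_set_const _ _ _ _ (snoc x (f x)) hFB); first by move=> a ha; exact: cF.
      by apply/hF; rewrite /graph snoc_last init_snoc.
    - apply/(family_set_const _ _ _ _ (snoc x (g x)) hGB); first by move=> a ha; exact: cG.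
      by apply/hG; rewrite /graph snoc_last init_snoc.
  have gpos : 0 < Rabs (g x) by exact: Rabs_pos_lt.
  have hlow : Rabs (g x) ^ N < phi ((((wA, wF), wG), x0), Rabs (g x)).
    apply: (H0 d0) => //; [lra| |lra].
    by apply: List.in_prod => //; apply: List.in_prod.
  have hup : phi ((((wA, wF), wG), x0), Rabs (g x)) <= Rabs (f x).
    have [Hl _] := Hphi ((((wA, wF), wG), x0), Rabs (g x)); apply: Hl; right.
    exists x, (f x), (g x); do !split=> //=; last lra.
    by move=> i; have := hn i; lra.
  have fpos : 0 < Rabs (f x) by have := pow_lt _ N gpos; lra.
  rewrite Rabs_mult Rabs_inv -RPow_abs.
  apply: Rle_lt_trans (_ : Rabs (g x) * 1 < _); last lra.
  rewrite /= Rmult_assoc; apply: Rmult_le_compat_l; first lra.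
  apply: (Rmult_le_reg_r (Rabs (f x))) => //.
  by rewrite Rmult_assoc Rinv_l; lra.
move=> x hx; case: (Req_dec (f x) 0) => fx.
  by rewrite fx (hfg x hx fx) /=; ring.
by rewrite Rmult_assoc Rinv_l // Rmult_1_r.
Qed.
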